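(* Let $M_1, M_2$ be positive integers and suppose that for each positive integer $N$, $\{\mu_{k,N} : 1\le k\le M_1+M_2\}$ is a family of permutations from $\mathcal{S}([N]^2)$ such that: (i) $\mu_{k,N}$ is symmetric for each $k\le M_1$ (and all $N$), and $\mathfrak{j}(\mu_{k,N}:\mu_{k,N}) = o(N^2)$ as $N\to\infty$ for each $M_1<k\le M_1+M_2$; (ii) whenever $a,b\in\{1,\dots,M_1+M_2\}$ and $a\neq b$, $$\#\big\{(i,j,k)\in[N]^3 : \mu_{a,N}(i,j)\in\{\mu_{b,N}(i,k),\ \mu_{b,N}(k,j),\ t\circ\mu_{b,N}\circ t(i,k),\ t\circ\mu_{b,N}\circ t(k,j)\}\big\} = o(N^2).$$ If, for each $N$, $G_N$ is an $N\times N$ Gaussian random matrix, then the limit in distribution, as $N\to\infty$, of the family $\{G_N^{\mu_{k,N}} : 1\le k\le M_1+M_2\}$ is a free family of $M_1$ semicircular (for $k\le M_1$) and $M_2$ circular (for $M_1<k\le M_1+M_2$) non-commutative random variables of variance $1$.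
   Context: $[N]=\{1,\dots,N\}$ and $\mathcal{S}([N]^2)$ is the group of permutations of the set $[N]\times[N]$. The permutation $t\in\mathcal{S}([N]^2)$ is $t(i,j)=(j,i)$. A permutation $\sigma\in\mathcal{S}([N]^2)$ is called symmetric if $t\circ\sigma\circ t=\sigma$. For $\sigma,\tau\in\mathcal{S}([N]^2)$, $$\mathfrak{j}(\sigma:\tau)=\#\{(i,j,k)\in[N]^3:\ \sigma(i,j)=t\circ\tau\circ t(k,j)\}.$$ For an $N\times N$ random matrix $A$ and $\sigma\in\mathcal{S}([N]^2)$, $A^\sigma$ is the $N\times N$ random matrix whose $(i,j)$-entry is the $\sigma(i,j)$-entry of $A$: $[A^\sigma]_{i,j}=[A]_{\sigma(i,j)}$. A random matrix $G_N=[g_{i,j}]_{1\le i,j\le N}$ is Gaussian if $g_{i,j}=\overline{g_{j,i}}$ for all $i,j$ and $\{g_{i,j}:1\le i\le j\le N\}$ is an independent family of mean-$0$ Gaussian random variables, complex for $i\ne j$ (with $E(g_{i,j}^2)=0$) and real for $i=j$, with $E(|g_{i,j}|^2)=1/N$. Equivalently the entries are jointly Gaussian, centered, with $E(g_{i,j}g_{k,l})=\frac1N\delta_{i,l}\delta_{j,k}$. A non-commutative probability space is a pair $(\mathfrak{A},\varphi)$ with $\mathfrak{A}$ a unital $*$-algebra over $\mathbb{C}$ and $\varphi:\mathfrak{A}\to\mathbb{C}$ a positive unital linear functional. $\mathrm{tr}$ is the normalized trace and $E$ the expectation. The limit in distribution of a finite family $\{A_{k,N}\}_k$ of random matrices is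 $\{a_k\}_k\subset\mathfrak{A}$ if every $*$-moment converges: $\lim_{N}E\circ\mathrm{tr}(A_{k_1,N}^{\epsilon_1}\cdots A_{k_R,N}^{\epsilon_R})=\varphi(a_{k_1}^{\epsilon_1}\cdots a_{k_R}^{\epsilon_R})$ for all $R$, all indices $k_1,\dots,k_R$, and $\epsilon_s\in\{1,*\}$. A semicircular element of variance $1$ is a selfadjoint $s$ whose only nonzero free cumulant is $\kappa_2(s,s)=1$; a circular element of variance $1$ is a $c$ whose only nonzero free cumulants in $c,c^*$ are $\kappa_2(c,c^* )=\kappa_2(c^*,c)=1$. For circular elements freeness is understood in the $*$-sense (of the generated unital $*$-algebras). *)

(* Defs.v *)
(* The complex numbers are R[i] for an arbitrary R : realType. *)
From HB Require Import structures.
From mathcomp Require Import all_boot all_order all_algebra all_fingroup.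
From mathcomp Require Import all_classical all_reals all_analysis.
From mathcomp Require Import complex.

Set Implicit Arguments.
Unset Strict Implicit.
Unset Printing Implicit Defensive.

Import Order.TTheory GRing.Theory Num.Theory.
Import numFieldNormedType.Exports.

Local Open Scope classical_set_scope.
Local Open Scope ring_scope.

Section EntryPermutations.
Variable N : nat.

Definition entry_perm := {perm 'I_N * 'I_N}.

Fact swap_pairK : involutive (fun x : 'I_N * 'I_N => (x.2, x.1)).
Proof. by case. Qed.

Definition transp : entry_perm := perm (inv_inj swap_pairK).

Lemma transpE i j : transp (i, j) = (j, i).
Proof. by rewrite permE. Qed.

(* The product s * u of permutations is "s, then u". *)
Definition conj_transp (s : entry_perm) : entry_perm :=
  (transp * s * transp)%g.

Lemma conj_transpE s x : conj_transp s x = transp (s (transp x)).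
Proof. by rewrite !permM. Qed.

Definition symmetric_perm (s : entry_perm) : Prop := conj_transp s = s.

Definition jcount (s u : entry_perm) : nat :=
  #|[set x : 'I_N * 'I_N * 'I_N |
      let: (i, j, k) := x in s (i, j) == conj_transp u (k, j)]%SET|.

Definition overlap_count (s u : entry_perm) : nat :=
  #|[set x : 'I_N * 'I_N * 'I_N |
      let: (i, j, k) := x in
      s (i, j) \in [:: u (i, k); u (k, j);
                       conj_transp u (i, k); conj_transp u (k, j)]]%SET|.

Definition permute_entries (C : Type) (A : 'M[C]_N) (s : entry_perm) :
  'M[C]_N := \matrix_(i, j) A (s (i, j)).1 (s (i, j)).2.

End EntryPermutations.

Definition is_o_square (R : realType) (u : nat -> nat) : Prop :=
  (fun N : nat => (u N)%:R : R^o) =o_\oo (fun N : nat => N%:R ^+ 2 : R^o).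

Section RandomVariables.
Variables (R : realType) (d : measure_display) (T : measurableType d).
Variable P : probability T R.

Definition cexpectation (Z : T -> R[i]) : R[i] :=
  (fine 'E_P[fun w => complex.Re (Z w)]%E
     +i* fine 'E_P[fun w => complex.Im (Z w)]%E)%C.

(* A constant is a (degenerate) Gaussian variable; [normal_prob] is the
   Gaussian law only for a nonzero standard deviation. *)
Definition gaussian_law (m s : R) (B : set R) : \bar R :=
  if s == 0 then \d_m B else normal_prob m s B.

Definition real_gaussian (X : T -> R) : Prop :=
  measurable_fun setT X /\
  exists m s : R, forall B : set R, measurable B ->
    P (X @^-1` B) = gaussian_law m s B.

(* The real and imaginary parts are jointly Gaussian. *)
Definition complex_gaussian (Z : T -> R[i]) : Prop :=
  forall a b : R,
    real_gaussian (fun w => a * complex.Re (Z w) + b * complex.Im (Z w)).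

Definition complex_coords (z : R[i]) : R * R := (complex.Re z, complex.Im z).

(* Mutual independence of the complex random variables Z x, x in D; the Borel
   subsets of the complex plane are those of R * R. *)
Definition independent_family (I : finType) (D : {set I})
    (Z : I -> T -> R[i]) : Prop :=
  forall (J : {set I}) (B : I -> set (R * R)),
    (J \subset D)%SET -> (forall x, measurable (B x)) ->
    P (\bigcap_(x in [set` J]) ((complex_coords \o Z x) @^-1` B x)) =
    (\prod_(x in J) P ((complex_coords \o Z x) @^-1` B x))%E.

Definition gaussian_matrix (N : nat) (G : T -> 'M[R[i]]_N) : Prop :=
  [/\ forall i j w, G w i j = (G w j i)^*,
      independent_family [set x : 'I_N * 'I_N | (x.1 <= x.2)%N]%SET
        (fun x w => G w x.1 x.2),
      forall i j : 'I_N, (i < j)%N ->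
        complex_gaussian (fun w => G w i j) /\
        cexpectation (fun w => G w i j ^+ 2) = 0,
      forall i : 'I_N, real_gaussian (fun w => complex.Re (G w i i)) &
      forall i j : 'I_N, (i <= j)%N ->
        cexpectation (fun w => G w i j) = 0 /\
        cexpectation (fun w => `|G w i j| ^+ 2) = N%:R^-1].

(* A word in symbols x_k, x_k^*; the boolean tells whether there is a star. *)
Definition star_moment (N : nat) (I : Type) (A : I -> T -> 'M[R[i]]_N)
    (s : seq (I * bool)) : R[i] :=
  cexpectation (fun w =>
    \tr (\big[mulmx/1%:M]_(x <- s)
           (if x.2 then map_mx Num.conj (A x.1 w)^T else A x.1 w)) / N%:R).

End RandomVariables.

Record ncProbSpace (C : numClosedFieldType) := NcProbSpace {
  nc_alg :> algType C;
  nc_star : nc_alg -> nc_alg;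
  nc_phi : {scalar nc_alg};
  nc_starK : involutive nc_star;
  nc_starD : {morph nc_star : x y / x + y};
  nc_starZ : forall (c : C) x, nc_star (c *: x) = c^* *: nc_star x;
  nc_starM : forall x y, nc_star (x * y) = nc_star y * nc_star x;
  nc_phi1 : nc_phi 1 = 1;
  nc_phi_ge0 : forall x, 0 <= nc_phi (nc_star x * x)
}.

Definition noncrossing (n : nat) (p : {set {set 'I_n}}) : bool :=
  [forall V in p, forall W in p, (V != W) ==>
     ~~ [exists a in V, exists b in W, exists c in V, exists e in W,
           [&& (a < b)%N, (b < c)%N & (c < e)%N]]].

Definition NC (n : nat) : {set {set {set 'I_n}}} :=
  [set p : {set {set 'I_n}} | finset.partition p [set: 'I_n] && noncrossing p]%SET.

Section FreeProbability.
Variables (C : numClosedFieldType) (A : ncProbSpace C).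
Implicit Types (s : seq A) (a x y : A).

(* The entries of s at the positions in V, in increasing order. *)
Definition subword s (V : {set 'I_(size s)}) : seq A :=
  [seq s`_i | i : 'I_(size s) <- enum V].

(* The free cumulant kappa_n(a_1, ..., a_n) of s = [:: a_1; ...; a_n] is
   obtained by solving the moment-cumulant formula ([moment_cumulant] below)
   for the term of the one-block partition; m is a recursion bound. *)
Fixpoint free_cumulant_rec (m : nat) s : C :=
  if m is m'.+1 then
    nc_phi A (\prod_(a <- s) a) -
    \sum_(p in NC (size s) | p != [set [set: 'I_(size s)]%SET]%SET)
      \prod_(V in p) free_cumulant_rec m' (subword V)
  else 0.

Definition free_cumulant s : C := free_cumulant_rec (size s) s.

Lemma size_subword s (V : {set 'I_(size s)}) : size (subword V) = #|V|.
Proof. by rewrite size_map cardE. Qed.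

Lemma partition_setT1 n (p : {set {set 'I_n}}) (V : {set 'I_n}) :
  (0 < n)%N -> finset.partition p [set: 'I_n]%SET -> V \in p ->
  p != [set [set: 'I_n]%SET]%SET -> (#|V| < n)%N.
Proof.
move=> n0 /and3P[cov triv p0] Vp pN1.
have := max_card (mem V); rewrite card_ord leq_eqVlt => /orP[/eqP Vn|//].
have VT : V = [set: 'I_n]%SET.
  by apply/eqP; rewrite eqEcard finset.subsetT cardsT card_ord Vn leqnn.
case/negP: pN1; apply/eqP/setP => W; rewrite inE; apply/idP/eqP => [Wp|->];
  last by rewrite -VT.
apply/eqP; rewrite -VT; apply: contraT => WV.
have /pred0P := (finset.trivIsetP triv _ _ Wp Vp WV).
have /set0Pn[i iW] : W != finset.set0 by apply: contraNneq p0 => <-.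
by move=> /(_ i) /=; rewrite iW VT inE.
Qed.

Lemma free_cumulant_recE m s :
  (size s <= m)%N -> free_cumulant_rec m s = free_cumulant s.
Proof.
elim/ltn_ind: m s => -[|m] IH s; first by rewrite leqn0 /free_cumulant => /eqP->.
have base k : (0 < size s)%N -> (k <= m)%N -> (size s <= k.+1)%N ->
  free_cumulant_rec k.+1 s =
  nc_phi A (\prod_(a <- s) a) -
  \sum_(p in NC (size s) | p != [set [set: 'I_(size s)]%SET]%SET)
    \prod_(V in p) free_cumulant (subword V).
  move=> s0 km sk /=; congr (_ - _); apply: eq_bigr => p /andP[].
  rewrite inE => /andP[pT _] pN; apply: eq_bigr => V Vp.
  apply: IH; first by rewrite ltnS.
  by rewrite size_subword -ltnS (leq_trans (partition_setT1 s0 pT Vp pN)).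
case: s base => [|x s] base sm.
  rewrite /free_cumulant /= big_nil nc_phi1 (big_pred1 finset.set0) ?big_set0 ?subrr//.
  move=> p; rewrite !inE /=; apply/andP/eqP => [[/andP[pT _] _]|->].
    apply/setP => V; rewrite inE; apply/negP => Vp.
    have /and3P[_ _ /negP] := pT; apply.
    by rewrite (_ : @finset.set0 _ = V)//; apply/setP => -[].
  split; last first.
    by apply/eqP => /setP /(_ [set: 'I_0]%SET); rewrite !inE eqxx.
  apply/andP; split; last by apply/forallP => V; rewrite inE.
  apply/and3P; split; rewrite ?inE//.
    by apply/eqP/setP => -[].
  by apply/finset.trivIsetP => V W; rewrite inE.
rewrite base// /free_cumulant -[size (x :: s)]/(size s).+1 base//.
Qed.

Lemma one_block_NC n : (0 < n)%N ->
  [set [set: 'I_n]%SET]%SET \in NC n.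
Proof.
move=> n0; rewrite inE; apply/andP; split.
  apply/and3P; split.
  - by rewrite /finset.cover big_set1.
  - by apply/finset.trivIsetP => V W; rewrite !inE => /eqP-> /eqP->; rewrite eqxx.
  - rewrite inE; apply/eqP => /setP /(_ (Ordinal n0)).
    by rewrite !inE.
apply/forallP => V; apply/implyP; rewrite inE => /eqP->.
by apply/forallP => W; apply/implyP; rewrite inE => /eqP->; rewrite eqxx.
Qed.

Lemma subword_setT s : subword [set: 'I_(size s)]%SET = s.
Proof.
rewrite /subword enum_setT -enumT.
rewrite -[RHS](mkseq_nth 0) /mkseq -val_enum_ord -map_comp.
by apply: eq_map.
Qed.

Lemma moment_cumulant s :
  nc_phi A (\prod_(a <- s) a) =
  \sum_(p in NC (size s)) \prod_(V in p) free_cumulant (subword V).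
Proof.
case: s => [|x s].
  rewrite big_nil nc_phi1 (big_pred1 finset.set0) ?big_set0//.
  move=> p; rewrite !inE /=; apply/idP/eqP => [/andP[pT _]|->].
    apply/setP => V; rewrite inE; apply/negP => Vp.
    have /and3P[_ _ /negP] := pT; apply.
    by rewrite (_ : @finset.set0 _ = V)//; apply/setP => -[].
  apply/andP; split; last by apply/forallP => V; rewrite inE.
  apply/and3P; split; rewrite ?inE//.
    by apply/eqP/setP => -[].
  by apply/finset.trivIsetP => V W; rewrite inE.
rewrite (bigD1 [set [set: 'I_(size (x :: s))]%SET]%SET) ?one_block_NC//=.
rewrite big_set1 subword_setT {1}/free_cumulant.
rewrite -[size (x :: s)]/(size s).+1 /=.
rewrite -addrA [X in _ = _ + X]addrC (_ : _ - _ = 0) ?addr0//.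
apply/eqP; rewrite subr_eq0; apply/eqP.
apply: eq_bigr => p /andP[].
rewrite inE => /andP[pT _] pN; apply: eq_bigr => V Vp.
apply/esym; rewrite free_cumulant_recE// size_subword -ltnS.
exact: (@partition_setT1 (size s).+1 p).
Qed.

Definition semicircular1 a : Prop :=
  nc_star a = a /\ forall n : nat, free_cumulant (nseq n a) = (n == 2)%:R.

Definition circular1 a : Prop :=
  forall e : seq bool,
    free_cumulant [seq (if b then nc_star a else a) | b <- e] =
    ((e == [:: false; true]) || (e == [:: true; false]))%:R.

(* The unital *-subalgebra generated by a. *)
Inductive star_generated a : A -> Prop :=
| star_gen_base : star_generated a a
| star_gen_one : star_generated a 1
| star_gen_add x y :
    star_generated a x -> star_generated a y -> star_generated a (x + y)
| star_gen_scale (c : C) x :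
    star_generated a x -> star_generated a (c *: x)
| star_gen_mul x y :
    star_generated a x -> star_generated a y -> star_generated a (x * y)
| star_gen_star x : star_generated a x -> star_generated a (nc_star x).

Definition star_free (I : eqType) (a : I -> A) : Prop :=
  forall s : seq (I * A),
    s != [::] -> sorted (fun p q => p.1 != q.1) s ->
    {in s, forall p, star_generated (a p.1) p.2 /\ nc_phi A p.2 = 0} ->
    nc_phi A (\prod_(p <- s) p.2) = 0.

Definition nc_star_moment (I : Type) (a : I -> A) (s : seq (I * bool)) : C :=
  nc_phi A (\prod_(x <- s) (if x.2 then nc_star (a x.1) else a x.1)).

End FreeProbability.

(* The matrices of size N live on a probability space depending on N. *)
Definition limit_in_distribution (R : realType) (d : nat -> measure_display)
    (T : forall N, measurableType (d N)) (P : forall N, probability (T N) R)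
    (I : Type) (A : forall N, I -> T N -> 'M[R[i]]_N)
    (S : ncProbSpace R[i]) (a : I -> S) : Prop :=
  forall s : seq (I * bool),
    (fun N => star_moment (P N) (A N) s : (R[i] : numFieldType))
      @ \oo --> (nc_star_moment a s : (R[i] : numFieldType)).

(* Main.v *)
(* By Wick's formula, a moment of the matrices is 1/N times a sum, over the closed
   paths spelled by the word and over the pairings of its letters, of products of
   covariances. The word is read from left to right with the stack of the letters
   that are still to be paired. A letter paired with the top of the stack gives
   back the same sum without both letters if these are adjoint to each other, and
   o(N) by the hypotheses on the permutations otherwise; a letter paired deeper in
   the stack determines one more vertex and gives O(1). In the limit, what remains
   is the number of ways to empty the stack, i.e. the vacuum expectation of the
   word on a full Fock space, where a letter acts as creation plus annihilation of
   its adjoint. There, positivity is the adjointness of creation and annihilation,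
   freeness holds because each colour acts only on the initial segment of that
   colour, and reading the stack as a noncrossing pairing gives the cumulants. *)
From mathcomp Require Import finmap.
From mathcomp Require Import monalg.
Require Import Defs.
From HB Require Import structures.
From mathcomp Require Import all_boot all_order all_algebra all_fingroup.
From mathcomp Require Import all_classical all_reals all_analysis.
From mathcomp Require Import measurable_realfun complex zify ring lra.

Set Implicit Arguments.
Unset Strict Implicit.
Unset Printing Implicit Defensive.

Import Order.TTheory GRing.Theory Num.Theory.
Import numFieldNormedType.Exports.

Local Open Scope classical_set_scope.
Local Open Scope ring_scope.

(** * Wick sums as a recursion on the word *)

Section WickSum.
Variables (K : comNzRingType) (V : Type) (C : V -> V -> K).

(** Pairings do not occur as objects in the probabilistic part. Wick's formula is kept as the
    recursion [wick], which reads one factor at a time and either leaves it open or contracts it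
    with an open one; the continuation [g] carries the rest of the sum. Real Gaussian variables,
    complex matrix entries, sums over paths and the stack count all have this shape, so each is
    compared with the next by induction on the word. The covariances of the matrix entries are 0 or
    1/N. Hence every error term is nonnegative, and it suffices to bound it above: with k open
    letters, what remains of a path between two given vertices contributes O(N^-k). The o(N^2)
    hypotheses enter through a single count, that of the two-step paths whose two entries are
    transposes of each other. The limit has to be an actual noncommutative probability space. Its
    algebra is the free algebra on the letters, where the star permutes the letters, and the Fock
    space serves to define the state on it. Vectors of the Fock space are plain functions on words,
    on which creation and annihilation are given by formulas. *)

Fixpoint contract (x : V) (g : seq V -> K) (l : seq V) : K :=
  if l is y :: r then C y x * g r + contract x (fun r' => g (y :: r')) r else 0.

(* [u] lists the factors that may only be contracted with factors of [w]. *)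
Fixpoint wick (g : seq V -> K) (u w : seq V) : K :=
  if w is x :: w' then
    wick g (x :: u) w' + contract x (fun u' => wick g u' w') u
  else g u.

Lemma eq_contract x g h l : g =1 h -> contract x g l = contract x h l.
Proof.
elim: l g h => //= y l IH g h gh.
by rewrite gh (IH _ (fun r => h (y :: r))).
Qed.

Lemma contractD x g h l :
  contract x (fun r => g r + h r) l = contract x g l + contract x h l.
Proof.
elim: l g h => /= [|y l IH] g h; first by rewrite addr0.
by rewrite IH; ring.
Qed.

Lemma contractZ x c g l : contract x (fun r => c * g r) l = c * contract x g l.
Proof.
elim: l g => /= [|y l IH] g; first by rewrite mulr0.
by rewrite IH; ring.
Qed.

End WickSum.

(** * Wick's formula from the Laplace transform *)

Section GaussianProcess.
Context {R : realType} d {T : measurableType d} (P : probability T R).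
Variables (U : lmodType R) (xi : U -> T -> R) (M : U -> R) (C : U -> U -> R).
Hypothesis mxi : forall u, measurable_fun setT (xi u).
Hypothesis xiP : forall a u v t, xi (a *: u + v) t = a * xi u t + xi v t.
Hypothesis MP : forall a u v, M (a *: u + v) = a * M u + M v.
Hypothesis CP : forall a u v w, C (a *: u + v) w = a * C u w + C v w.
Hypothesis CC : forall u v, C u v = C v u.
Hypothesis mgf : forall u,
  (\int[P]_t (expR (xi u t))%:E = (expR (M u + C u u / 2))%:E)%E.

(** The dominating function: [expR y + expR (- y)] bounds [|y|], and the product expands into
    exponentials of elements of the process, each integrable by [mgf]. The factor [expR (xi z t)]
    leaves a direction in which to differentiate. *)
Let cosh_prod l z t :=
  (\prod_(x <- l) (expR (xi x t) + expR (- xi x t))) * expR (xi z t).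
Let mom l z t := (\prod_(x <- l) xi x t) * expR (xi z t).

Let mexp (f : T -> R) : measurable_fun setT f ->
  measurable_fun setT (fun t => expR (f t)).
Proof. by move=> mf; apply: measurableT_comp. Qed.

Let mprod (I : Type) (h : I -> T -> R) l : (forall x, measurable_fun setT (h x)) ->
  measurable_fun setT (fun t => \prod_(x <- l) h x t).
Proof.
move=> mh; elim: l => [|x l IH].
  by under eq_fun do rewrite big_nil; exact: measurable_cst.
by under eq_fun do rewrite big_cons; exact: measurable_funM.
Qed.

Let mmom l z : measurable_fun setT (mom l z).
Proof. by apply: measurable_funM; [exact: mprod|exact: mexp]. Qed.

Let int_cosh l z : P.-integrable setT (EFin \o cosh_prod l z).
Proof.
elim: l z => [|x l IH] z.
  rewrite /cosh_prod; apply/integrableP; split.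
    apply/measurable_EFinP; under eq_fun do rewrite big_nil mul1r.
    exact: mexp.
  under eq_integral do rewrite /= big_nil mul1r ger0_norm ?expR_ge0//.
  by rewrite mgf ltry.
have -> : EFin \o cosh_prod (x :: l) z =
    (EFin \o cosh_prod l (1 *: x + z)) \+ (EFin \o cosh_prod l (- 1 *: x + z)).
  apply/funext => t; rewrite /= -EFinD /cosh_prod big_cons !xiP.
  by rewrite !expRD mul1r mulN1r; congr EFin; ring.
exact: integrableD.
Qed.

Let norm_le_cosh (x : R) : `|x| <= expR x + expR (- x).
Proof.
have := expR_ge1Dx x; have := expR_ge1Dx (- x).
have := expR_ge0 x; have := expR_ge0 (- x).
by rewrite ler_norml => ? ? ? ?; apply/andP; split; lra.
Qed.

Let mom_le l z t : `|mom l z t| <= cosh_prod l z t.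
Proof.
rewrite /mom /cosh_prod normrM (ger0_norm (expR_ge0 _)).
apply: ler_wpM2r; first exact: expR_ge0.
elim: l => [|x l IH]; first by rewrite !big_nil normr1.
by rewrite !big_cons normrM ler_pM// norm_le_cosh.
Qed.

Let cosh_ge0 l z t : 0 <= cosh_prod l z t.
Proof. exact: le_trans (normr_ge0 _) (mom_le l z t). Qed.

Let int_mom l z : P.-integrable setT (EFin \o mom l z).
Proof.
apply: (le_integrable _ _ _ (int_cosh l z)) => //.
  by apply/measurable_EFinP.
by move=> t _; rewrite lee_fin (ger0_norm (cosh_ge0 _ _ _)).
Qed.

Lemma gaussian_moment_integrable l :
  P.-integrable setT (EFin \o (fun t => \prod_(x <- l) xi x t)).
Proof.
have := int_mom l 0; rewrite /mom; apply: eq_integrable => // t _ /=.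
by have := xiP 1 0 0 t; rewrite scaler0 addr0 mul1r => e; rewrite (_ : xi 0 t = 0) ?expR0 ?mulr1//; lra.
Qed.

Let F l z := \int[P]_t mom l z t.

Let F_derive l x z : is_derive (0 : R) 1 (fun s => F l (s *: x + z)) (F (x :: l) z).
Proof.
pose f s t := mom l (s *: x + z) t.
have fE s t : f s t = (\prod_(x <- l) xi x t) * expR (s * xi x t + xi z t).
  by rewrite /f /mom xiP.
have df (s : R) (t : T) : is_derive s 1 (f ^~ t) (xi x t * mom l (s *: x + z) t).
  rewrite (_ : f ^~ t = fun s => (\prod_(x <- l) xi x t) * expR (s * xi x t + xi z t)); last first.
    by apply/funext => s'; exact: fE.
  apply: is_derive_eq; rewrite /mom xiP /GRing.scale/=; ring.
have I0 : `]-1, 1[%classic (0 : R) by rewrite /= in_itv/= ltrN10 ltr01.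
have intf (s : R) : `]-1, 1[%classic s -> P.-integrable setT (EFin \o f s).
  by move=> _; exact: int_mom.
have derf (s : R) (t : T) : `]-1, 1[%classic s -> setT t -> derivable (f ^~ t) s 1.
  by move=> _ _; have [] := df s t.
(* One copy of [x] dominates the factor [xi x t] that is brought down, the other dominates
   [expR (s * xi x t)] for [|s| < 1]. *)
pose G t := cosh_prod (x :: x :: l) z t.
have Gub (s : R) (t : T) : `]-1, 1[%classic s -> setT t -> `|partial1of2 f s t| <= G t.
  rewrite /= in_itv/= => /andP[s1 s2] _.
  have -> : partial1of2 f s t = xi x t * mom l (s *: x + z) t.
    by rewrite partial1of2E; exact: (@derive_val _ _ _ _ _ _ _ (df s t)).
  rewrite /G {1}/cosh_prod big_cons normrM -mulrA.
  apply: ler_pM => //.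
  apply: le_trans (mom_le _ _ _) _.
  rewrite /cosh_prod big_cons [leRHS]mulrAC mulrC; apply: ler_wpM2r.
    by apply: prodr_ge0 => y _; rewrite addr_ge0 ?expR_ge0.
  rewrite xiP expRD; apply: ler_wpM2r; first exact: expR_ge0.
  have e1 := expR_ge0 (xi x t); have e2 := expR_ge0 (- xi x t).
  case: (leP 0 (xi x t)) => x0.
    have : expR (s * xi x t) <= expR (xi x t) by rewrite ler_expR; nra.
    lra.
  have : expR (s * xi x t) <= expR (- xi x t) by rewrite ler_expR; nra.
  lra.
have mT : measurable (setT : set T) by [].
have D := derivable_under_integral mT I0 intf derf (fun t => cosh_ge0 _ _ _)
  (int_cosh _ _) Gub.
have E := differentiation_under_integral mT I0 intf derf (fun t => cosh_ge0 _ _ _)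
  (int_cosh _ _) Gub.
apply: DeriveDef; first exact: D.
rewrite -derive1E E; apply: eq_Rintegral => t _.
rewrite -/(partial1of2 f 0 t) partial1of2E.
rewrite (@derive_val _ _ _ _ _ _ _ (df 0 t)) scale0r add0r.
by rewrite /mom big_cons mulrA.
Qed.

Let q z := M z + C z z / 2.
(** Tilting the measure by [expR (xi z t)] keeps the covariance and shifts the mean of [x] by
    [C x z]; [expR (q z)] is the total mass after the tilt. *)
Let f z (u : seq U) := expR (q z) * \prod_(x <- u) (M x + C x z).

Let CPr a u v w : C w (a *: u + v) = a * C w u + C w v.
Proof. by rewrite CC CP !(CC w). Qed.

Let contract_derive (x : U) (g : R -> seq U -> R) (g' : seq U -> R) u :
  (forall r, is_derive (0 : R) 1 (g ^~ r) (g' r)) ->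
  is_derive (0 : R) 1 (fun s => contract C x (g s) u) (contract C x g' u).
Proof.
elim: u g g' => [|y u IH] g g' gd /=; first exact: is_derive_cst.
have D2 := IH (fun s r => g s (y :: r)) (fun r => g' (y :: r)) (fun r => gd (y :: r)).
have D1 := gd u.
exact: is_deriveD.
Qed.

Let f_cons z x u : f z (x :: u) = (M x + C x z) * f z u.
Proof. by rewrite /f big_cons; ring. Qed.

Let f_derive x z u : is_derive (0 : R) 1 (fun s => f (s *: x + z) u)
  (f z (x :: u) + contract C x (f z) u).
Proof.
elim: u => [|y u IH].
  have -> : (fun s => f (s *: x + z) [::]) =
    (fun s => expR (s * M x + M z + (s * s * C x x + 2 * s * C x z + C z z) / 2)).
    apply/funext => s; rewrite /f big_nil mulr1 /q MP CP !CPr (CC z x).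
    by congr expR; field.
  apply: is_derive_eq; rewrite /f /= /GRing.scale/= big_cons big_nil /q.
  rewrite (_ : 0 * M x + M z + (0 * 0 * C x x + 2 * 0 * C x z + C z z) / 2 = M z + C z z / 2); last by field.
  by field.
have -> : (fun s => f (s *: x + z) (y :: u)) =
    (fun s => M y + (s * C y x + C y z)) * (fun s => f (s *: x + z) u).
  by apply/funext => s; rewrite /f big_cons CPr fctE; ring.
apply: is_derive_eq; rewrite /= !scale0r add0r.
rewrite (@eq_contract _ _ _ _ (fun r => f z (y :: r)) (fun r => (M y + C y z) * f z r)); last first.
  by move=> r; exact: f_cons.
rewrite (contractZ C x (M y + C y z) (f z)) !f_cons /GRing.scale/=; ring.
Qed.

(* Differentiating [f] in the direction [x] either brings down a new linear
   factor or contracts one of the old ones, as in the recursion of [wick]. *)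
Let wick_derive x z u w :
  is_derive (0 : R) 1 (fun s => wick C (f (s *: x + z)) u w)
    (wick C (f z) u (rcons w x)).
Proof.
elim: w u => [|y w IH] u /=; first exact: f_derive.
have D1 := IH (y :: u).
have D2 := contract_derive y (g := fun s r => wick C (f (s *: x + z)) r w) u IH.
exact: is_deriveD.
Qed.

(** Both sides have the same derivative along [x], by the induction hypothesis for all [z]. A factor
    brought down by differentiation is the last one that [wick] reads, hence the induction from the
    right. *)
Let F_wick l z : F l z = wick C (f z) [::] l.
Proof.
elim/last_ind: l z => [|l x IH] z.
  rewrite /F /f /mom /= big_nil mulr1 /Rintegral.
  by under eq_integral do rewrite big_nil mul1r; rewrite mgf.
have -> : F (rcons l x) z = F (x :: l) z.
  apply: eq_Rintegral => t _; rewrite /mom; congr (_ * _).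
  by apply: perm_big; rewrite perm_rcons.
have := F_derive l x z; have := wick_derive x z [::] l.
have -> : (fun s => F l (s *: x + z)) = (fun s => wick C (f (s *: x + z)) [::] l).
  by apply/funext => s; exact: IH.
by move=> d1 d2; rewrite -(@derive_val _ _ _ _ _ _ _ d1) (@derive_val _ _ _ _ _ _ _ d2).
Qed.

Lemma gaussian_wick l :
  \int[P]_t (\prod_(x <- l) xi x t) =
  wick C (fun u => \prod_(x <- u) M x) [::] l.
Proof.
have xi0 t : xi 0 t = 0.
  by have := xiP 1 0 0 t; rewrite scaler0 addr0 mul1r => e; lra.
have M0 : M 0 = 0.
  by have := MP 1 0 0; rewrite scaler0 addr0 mul1r => e; lra.
have C0 u : C u 0 = 0.
  by have := CPr 1 0 0 u; rewrite scaler0 addr0 mul1r => e; lra.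
have := F_wick l 0.
have -> : F l 0 = \int[P]_t (\prod_(x <- l) xi x t).
  by apply: eq_Rintegral => t _; rewrite /mom xi0 expR0 mulr1.
move=> ->; congr (wick C _ _ _); apply/funext => u.
rewrite /f /q M0 C0 mul0r addr0 expR0 mul1r.
by apply: eq_bigr => x _; rewrite C0 addr0.
Qed.

End GaussianProcess.

(** * Integrals against images of measures with densities *)

Section ImageDensity.
Context {R : realType}.
Local Open Scope ereal_scope.
Import HBNNSimple.

Let simple_integral d d' (T : measurableType d) (Y : measurableType d')
    (mu : {measure set T -> \bar R}) (X : T -> Y) (g : T -> R)
    (h : {nnsfun Y >-> R}) :
  measurable_fun setT X -> measurable_fun setT g -> (forall t, 0 <= g t)%R ->
  \int[mu]_t (h (X t) * g t)%:E =
  \sum_(k \in range h) k%:E * \int[mu]_(t in X @^-1` (h @^-1` [set k])) (g t)%:E.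
Proof.
move=> mX mg g0.
have mpre k : measurable (X @^-1` (h @^-1` [set k])).
  by rewrite -[X @^-1` _]setTI; exact: mX.
have mind k : measurable_fun setT (fun t => \1_(h @^-1` [set k]) (X t) * g t)%R.
  by apply: measurable_funM => //; apply: measurableT_comp.
transitivity (\int[mu]_t (\sum_(k \in range h)
   (k%:E * (\1_(h @^-1` [set k]) (X t) * g t)%:E))).
  apply: eq_integral => t _; rewrite fimfunE EFinM -fsumEFin// ge0_mule_fsuml; last first.
    by move=> k; rewrite nnfun_muleindic_ge0.
  by apply: eq_fsbigr => k _; rewrite -!EFinM mulrA.
rewrite ge0_integral_fsum//.
- apply: eq_fsbigr => k; rewrite inE => -[y _ hk].
  have k0 : (0 <= k)%R by rewrite -hk.
  rewrite ge0_integralZl//; last 2 first.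
  - exact/measurable_EFinP.
  - by move=> t _; rewrite lee_fin mulr_ge0.
  congr (_ * _); rewrite [RHS]integral_mkcond; apply: eq_integral => t _.
  rewrite patchE indicE; have [H|H] := boolP (X t \in h @^-1` [set k]).
    by rewrite mem_set ?mul1r//; move: H; rewrite inE.
  by rewrite memNset ?mul0r//; apply: contraNnot H; rewrite inE.
- by move=> k; apply: measurable_funeM; apply/measurable_EFinP.
- move=> k t _; have [[y _ hk]|nk] := pselect (range h k).
    by rewrite -EFinM lee_fin mulr_ge0 ?mulr_ge0// -hk.
  rewrite indicE memNset ?mul0r ?mule0// => hk.
  by apply: nk; exists (X t).
Qed.

Let approx_integral d d' (T : measurableType d) (Y : measurableType d')
    (mu : {measure set T -> \bar R}) (X : T -> Y) (g : T -> R) (f : Y -> R)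
    (mf : measurable_fun setT (EFin \o f)) :
  measurable_fun setT X -> measurable_fun setT g -> (forall t, 0 <= g t)%R ->
  (forall y, 0 <= f y)%R ->
  \int[mu]_t (f (X t) * g t)%:E =
  limn (fun n => \int[mu]_t (nnsfun_approx measurableT mf n (X t) * g t)%:E).
Proof.
move=> mX mg g0 f0; set h := nnsfun_approx _ _.
rewrite -monotone_convergence//.
- apply: eq_integral => t _; apply/esym/cvg_lim => //.
  rewrite EFinM; under eq_fun do rewrite EFinM.
  apply: cvgeZr => //.
  have ff0 (y : Y) : setT y -> 0 <= (EFin \o f) y by rewrite /= lee_fin.
  exact: (cvg_nnsfun_approx measurableT mf ff0 (x := X t)).
- move=> n; apply/measurable_EFinP/measurable_funM => //.
  by apply: measurableT_comp.
- by move=> n t _; rewrite lee_fin mulr_ge0.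
- move=> t _ m n mn; rewrite lee_fin ler_wpM2r//.
  exact/lefP/nd_nnsfun_approx.
Qed.

(** Monotone convergence along simple functions extends the equality from sets to functions. It is
    used to pass from the law of a variable to its Laplace transform, and to split one factor off a
    product of independent variables. *)
Lemma ge0_integral_image_density d1 d2 d' (T1 : measurableType d1)
    (T2 : measurableType d2) (Y : measurableType d')
    (mu1 : {measure set T1 -> \bar R}) (mu2 : {measure set T2 -> \bar R})
    (X1 : T1 -> Y) (X2 : T2 -> Y) (g1 : T1 -> R) (g2 : T2 -> R) (f : Y -> R) :
  measurable_fun setT X1 -> measurable_fun setT X2 ->
  measurable_fun setT g1 -> measurable_fun setT g2 ->
  (forall t, 0 <= g1 t)%R -> (forall t, 0 <= g2 t)%R ->
  (forall B, measurable B -> \int[mu1]_(t in X1 @^-1` B) (g1 t)%:E =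
                             \int[mu2]_(t in X2 @^-1` B) (g2 t)%:E) ->
  measurable_fun setT f -> (forall y, 0 <= f y)%R ->
  \int[mu1]_t (f (X1 t) * g1 t)%:E = \int[mu2]_t (f (X2 t) * g2 t)%:E.
Proof.
move=> mX1 mX2 mg1 mg2 g10 g20 E mf f0.
have mf' : measurable_fun setT (EFin \o f) by exact/measurable_EFinP.
rewrite (approx_integral mu1 mf')// (approx_integral mu2 mf')//.
congr (limn _); apply/funext => n.
by rewrite !simple_integral//; apply: eq_fsbigr => k _; rewrite E.
Qed.

End ImageDensity.

(** * Real Gaussian variables *)

Section RealGaussian.
Context {R : realType} d {T : measurableType d} (P : probability T R).

(** Completing the square: the factor [expR (t * x)] moves the mean from [m] to [m + t * s ^+ 2]. *)
Lemma integral_normal_pdf_expR (m s t : R) : s != 0 ->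
  (\int[lebesgue_measure]_x (expR (t * x) * normal_pdf m s x)%:E =
  (expR (t * m + t ^+ 2 * s ^+ 2 / 2))%:E)%E.
Proof.
move=> s0.
have E x : expR (t * x) * normal_pdf m s x =
  expR (t * m + t ^+ 2 * s ^+ 2 / 2) * normal_pdf (m + t * s ^+ 2) s x.
  rewrite !normal_pdfE// /normal_fun mulrCA [RHS]mulrCA -!expRD.
  by congr (_ * expR _); field.
under eq_integral do rewrite E EFinM.
rewrite ge0_integralZl//.
- by rewrite integral_normal_pdf mule1.
- by apply/measurable_EFinP; exact: measurable_normal_pdf.
- by move=> x _; rewrite lee_fin normal_pdf_ge0.
Qed.

Lemma gaussian_law_mgf (X : T -> R) (m s t : R) : measurable_fun setT X ->
  (forall B : set R, measurable B -> P (X @^-1` B) = gaussian_law m s B) ->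
  (\int[P]_w (expR (t * X w))%:E =
  (expR (t * m + t ^+ 2 * s ^+ 2 / 2))%:E)%E.
Proof.
move=> mX law.
have me : measurable_fun setT (fun x : R => expR (t * x)).
  by apply: measurableT_comp => //; exact: measurable_funM.
have mpre (B : set R) : measurable B -> measurable (X @^-1` B).
  by move=> mB; rewrite -[X @^-1` _]setTI; exact: mX.
under eq_integral do rewrite -[expR _]mulr1.
(* A zero deviation gives a point mass, which has no Lebesgue density; the comparison is then with
   [dirac m]. *)
have [s0|s0] := eqVneq s 0.
  rewrite (@ge0_integral_image_density R _ _ _ T _ _ P (dirac m) X id
    (fun=> 1) (fun=> 1) (fun x => expR (t * x)))//.
  - under eq_integral do rewrite mulr1.
    rewrite integral_dirac//; last exact/measurable_EFinP.
    by rewrite diracE in_setT mul1e s0 expr0n/= mulr0 mul0r addr0.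
  - move=> B mB; rewrite !integral_cst ?mul1e//; last exact: mpre.
    by apply: etrans (law _ mB) _; rewrite /gaussian_law s0 eqxx.
rewrite -(integral_normal_pdf_expR m t s0).
apply: (@ge0_integral_image_density R _ _ _ T _ _ P lebesgue_measure X id
    (fun=> 1) (normal_pdf m s) (fun x => expR (t * x))) => //.
- exact: measurable_normal_pdf.
- by move=> x; exact: normal_pdf_ge0.
- move=> B mB; rewrite integral_cst ?mul1e//; last exact: mpre.
  by apply: etrans (law _ mB) _; rewrite /gaussian_law (negPf s0).
Qed.

End RealGaussian.

Section GaussianMoments.
Context {R : realType} d {T : measurableType d} (P : probability T R).

(** [real_gaussian] hides the parameters of the law. They are recovered from the first two moments,
    computed by Wick's formula for the process of multiples of [X]; this is how conditions on
    moments determine a Laplace transform. *)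
Lemma real_gaussian_moments (X : T -> R) : real_gaussian P X ->
  [/\ P.-integrable setT (EFin \o X),
      P.-integrable setT (EFin \o (fun t => X t * X t)) &
      forall m v, \int[P]_t X t = m -> \int[P]_t (X t * X t) = m ^+ 2 + v ->
      forall a, (\int[P]_t (expR (a * X t))%:E =
                 (expR (a * m + a ^+ 2 * v / 2))%:E)%E].
Proof.
move=> [mX [m0 [s law]]].
have mgf := gaussian_law_mgf _ mX law.
pose xi (u : R^o) t := u * X t; pose M (u : R^o) := u * m0.
pose C (u v : R^o) := u * v * s ^+ 2.
have mxi u : measurable_fun setT (xi u) by exact: measurable_funM.
have xiP (a : R) (u v : R^o) t : xi (a *: u + v) t = a * xi u t + xi v t.
  by rewrite /xi /GRing.scale/=; ring.
have MP (a : R) (u v : R^o) : M (a *: u + v) = a * M u + M v.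
  by rewrite /M /GRing.scale/=; ring.
have CP (a : R) (u v w : R^o) : C (a *: u + v) w = a * C u w + C v w.
  by rewrite /C /GRing.scale/=; ring.
have CC u v : C u v = C v u by rewrite /C; ring.
have mgf' u : (\int[P]_t (expR (xi u t))%:E = (expR (M u + C u u / 2))%:E)%E.
  by rewrite mgf /M /C expr2.
have int := gaussian_moment_integrable mxi xiP mgf'.
have E := gaussian_wick mxi xiP MP CP CC mgf'.
have i1 := int [:: 1]; have i2 := int [:: 1; 1].
have E1 := E [:: 1]; have E2 := E [:: 1; 1].
have e1 : (fun t => \prod_(x <- [:: 1]) xi x t) = X.
  by apply/funext => t; rewrite big_seq1 /xi mul1r.
have e2 : (fun t => \prod_(x <- [:: 1; 1]) xi x t) = (fun t => X t * X t).
  by apply/funext => t; rewrite !big_cons big_nil /xi; ring.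
rewrite e1 in i1; rewrite e2 in i2.
rewrite e1 /= !big_cons !big_nil in E1; rewrite e2 /= !big_cons !big_nil in E2.
split => // m v; rewrite E1 E2 => em ev a; rewrite mgf.
have hm : m0 = m by rewrite -em /M; ring.
have -> // : v = s ^+ 2.
  by apply: (addrI (m ^+ 2)); rewrite -ev -hm /M /C; ring.
by rewrite hm.
Qed.

End GaussianMoments.

(** * Independence, from sets to functions *)

Section Independence.
Context {R : realType} d {T : measurableType d} (P : probability T R).
Local Notation coords := (@complex_coords R).
Variables (I : finType) (D : {set I}) (Z : I -> T -> R[i]).
Hypothesis mZ : forall x, x \in D -> measurable_fun setT (coords \o Z x).
Hypothesis indep : independent_family P D Z.

Let mprod (A : pred I) (phi : I -> R * R -> R) :
  (forall x, A x -> x \in D) ->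
  (forall x, x \in D -> measurable_fun setT (phi x)) ->
  measurable_fun setT (fun t => \prod_(x | A x) phi x (coords (Z x t))).
Proof.
move=> AD mphi.
under eq_fun do rewrite -big_filter.
have : all A [seq x <- index_enum I | A x] by exact: filter_all.
elim: [seq x <- _ | _] => [_|x s IH /= /andP[Ax As]].
  by under eq_fun do rewrite big_nil; exact: measurable_cst.
under eq_fun do rewrite big_cons; apply: measurable_funM; last exact: IH.
have xD := AD _ Ax.
exact: (measurableT_comp (mphi _ xD) (mZ xD)).
Qed.

Lemma independent_prod_integral (phi : I -> R * R -> R) (c : I -> R) :
  (forall x, x \in D -> measurable_fun setT (phi x)) ->
  (forall x z, 0 <= phi x z) ->
  (forall x, x \in D ->
     (\int[P]_t (phi x (coords (Z x t)))%:E = (c x)%:E)%E) ->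
  (\int[P]_t (\prod_(x in D) phi x (coords (Z x t)))%:E =
   (\prod_(x in D) c x)%:E)%E.
Proof.
(* Functions replace indicators one index at a time: [s] lists the indices whose factor need not be
   an indicator. For empty [s] this is the definition of independence. *)
move: phi c; suff H (s : seq I) (psi : I -> R * R -> R) (b : I -> R) :
    (forall x, x \in D -> measurable_fun setT (psi x)) ->
    (forall x z, 0 <= psi x z) ->
    (forall x, x \in D -> x \notin s ->
       exists2 B, measurable B & psi x = \1_B) ->
    (forall x, x \in D ->
       (\int[P]_t (psi x (coords (Z x t)))%:E = (b x)%:E)%E) ->
    (\int[P]_t (\prod_(x in D) psi x (coords (Z x t)))%:E =
     (\prod_(x in D) b x)%:E)%E.
  move=> phi c mphi phi0 phic; apply: (H (enum I)) => // x _.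
  by rewrite mem_enum.
elim: s psi b => [|x s IH] psi b mpsi psi0 psiB psib.
  have /choice[B BP] : forall x, exists B : set (R * R),
      measurable B /\ (x \in D -> psi x = \1_B).
    move=> x; have [xD|xD] := boolP (x \in D); last by exists set0.
    by have [B ? ?] := psiB x xD isT; exists B.
  have mpre x : x \in D -> measurable ((coords \o Z x) @^-1` B x).
    move=> xD; rewrite -[_ @^-1` _]setTI; apply: (mZ xD) => //.
    exact: (BP x).1.
  transitivity (P (\bigcap_(x in [set` D]) ((coords \o Z x) @^-1` B x))).
    rewrite -[X in P X]setIT -integral_indic//; last first.
      by apply: fin_bigcap_measurable => // x xD; exact: mpre.
    apply: eq_integral => t _; congr EFin.
    have [tB|tB] := boolP (t \in \bigcap_(x in [set` D])
      ((coords \o Z x) @^-1` B x)).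
      rewrite indicE tB big1// => x xD; rewrite (BP x).2// indicE mem_set//.
      by move: tB; rewrite inE; apply.
    rewrite indicE (negPf tB); move: tB.
    move=> /negP tB; have [x xD xB] : exists2 x, x \in D &
        ~ B x (coords (Z x t)).
      apply: contra_notP tB => H; rewrite inE => x xD /=.
      by apply: contra_notP H => H; exists x.
    by rewrite (bigD1 x)//= (BP x).2// indicE memNset ?mul0r.
  rewrite indep//; last by move=> x; exact: (BP x).1.
  rewrite -prodEFin; apply: eq_bigr => x xD.
  rewrite -psib// -[X in P X]setIT -integral_indic//; last exact: mpre.
  by apply: eq_integral => t _; rewrite (BP x).2.
have [xD|xD] := boolP (x \in D); last first.
  apply: IH => // y yD ys; apply: psiB => //; rewrite inE negb_or ys andbT.
  by apply: contraNneq xD => <-.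
set X := coords \o Z x.
pose g t := \prod_(y in D | y != x) psi y (coords (Z y t)).
pose c := \prod_(y in D | y != x) b y.
have g0 t : 0 <= g t by apply: prodr_ge0.
have c0 : 0 <= c.
  apply: prodr_ge0 => y /andP[yD _].
  by rewrite -lee_fin -psib//; apply: integral_ge0 => t _; rewrite lee_fin.
have mg : measurable_fun setT g.
  by apply: mprod => // y /andP[].
transitivity (\int[P]_t (psi x (X t) * g t)%:E)%E.
  by apply: eq_integral => t _; rewrite (bigD1 x).
have mpre (B : set (R * R)) : measurable B -> measurable (X @^-1` B).
  by move=> mB; rewrite -[_ @^-1` _]setTI; exact: mZ.
(* The measures [B |-> \int_(X @^-1` B) g] and [B |-> c * P (X @^-1` B)] agree
   by induction, as [\1_B] may be substituted for [psi x]. *)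
rewrite (@ge0_integral_image_density R _ _ _ T T _ P P X X g (fun=> c))//.
- under eq_integral do rewrite mulrC EFinM.
  rewrite ge0_integralZl//.
  + by rewrite psib// -EFinM mulrC [in RHS](bigD1 x).
  + by apply/measurable_EFinP; exact: (measurableT_comp (mpsi _ xD) (mZ xD)).
  + by move=> t _; rewrite lee_fin.
- exact: mZ.
- exact: mZ.
- move=> B mB.
  have mXB := mpre B mB.
  have PB : P (X @^-1` B) \is a fin_num by apply: fin_num_measure.
  pose psi' y := if y == x then \1_B else psi y.
  pose b' y := if y == x then fine (P (X @^-1` B)) else b y.
  have -> : (\int[P]_(t in X @^-1` B) (g t)%:E =
      \int[P]_t (\prod_(y in D) psi' y (coords (Z y t)))%:E)%E.
    rewrite integral_mkcond; apply: eq_integral => t _.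
    rewrite (bigD1 x)//= /psi' eqxx.
    have -> : \prod_(y in D | y != x) (if y == x then \1_B else psi y)
       (coords (Z y t)) = g t.
      by apply: eq_bigr => y /andP[_ /negPf ->].
    rewrite patchE indicE; have [H|H] := boolP (t \in X @^-1` B).
      by rewrite mem_set ?mul1r//; move: H; rewrite inE.
    by rewrite memNset ?mul0r//; apply: contraNnot H; rewrite inE.
  rewrite (IH psi' b').
  + transitivity (c%:E * P (X @^-1` B))%E; last by rewrite integral_cst.
    rewrite -(fineK PB) -EFinM; congr EFin.
    rewrite (bigD1 x)//= /b' eqxx mulrC; congr (_ * _).
    by apply: eq_bigr => y /andP[_ /negPf ->].
  + by move=> y yD; rewrite /psi'; case: ifP => _; [exact: measurable_indic|exact: mpsi].
  + by move=> y z; rewrite /psi'; case: ifP.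
  + move=> y yD ys; rewrite /psi'; case: eqVneq => [_|yx]; first by exists B.
    by apply: psiB => //; rewrite inE negb_or yx.
  + move=> y yD; rewrite /psi' /b'; case: eqVneq => [->|yx]; last exact: psib.
    rewrite fineK// -[X in P X]setIT -integral_indic//.
- exact: mpsi.
Qed.

End Independence.

(** * Wick sums of complex combinations of real variables *)

Section ComplexExpansion.
Variables (K : comNzRingType) (I V : Type) (j : K) (re im : I -> V).

(** Multilinear expansion: each letter [y] stands for [re y + j * im y], and [g] is the multilinear
    form, given on words of real letters. *)
Fixpoint expand (g : seq V -> K) (l : seq I) : K :=
  if l is y :: r then
    expand (fun s => g (re y :: s)) r + j * expand (fun s => g (im y :: s)) r
  else g [::].

Lemma eq_expand g h l : g =1 h -> expand g l = expand h l.
Proof.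
elim: l g h => //= y l IH g h gh.
by congr (_ + _ * _); apply: IH => s; exact: gh.
Qed.

Lemma expandD g h l : expand (fun s => g s + h s) l = expand g l + expand h l.
Proof. by elim: l g h => //= y l IH g h; rewrite !IH; ring. Qed.

Lemma expandZ c g l : expand (fun s => c * g s) l = c * expand g l.
Proof. by elim: l g => //= y l IH g; rewrite !IH; ring. Qed.

Lemma expand0 l : expand (fun=> 0) l = 0.
Proof. by elim: l => //= y l IH; rewrite IH mulr0 addr0. Qed.

Lemma expand_prod (f : V -> K) l :
  expand (fun s => \prod_(x <- s) f x) l =
  \prod_(y <- l) (f (re y) + j * f (im y)).
Proof.
elim: l => [|y l IH] /=; first by rewrite !big_nil.
rewrite big_cons -IH.
rewrite (@eq_expand _ (fun s => f (re y) * \prod_(x <- s) f x)); last first.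
  by move=> s; rewrite big_cons.
rewrite [X in _ + _ * X](@eq_expand _ (fun s => f (im y) * \prod_(x <- s) f x)); last first.
  by move=> s; rewrite big_cons.
by rewrite !expandZ; ring.
Qed.

Variables (C : V -> V -> K) (g : seq V -> K).

Definition expand_cov (y z : I) : K :=
  C (re y) (re z) + j * C (im y) (re z) +
  j * (C (re y) (im z) + j * C (im y) (im z)).

Let contract_expand x (h : seq V -> seq V -> K) u w :
  expand (fun s => contract C x (fun r => h r s) u) w =
  contract C x (fun r => expand (h r) w) u.
Proof.
elim: u h => [|y u IH] h /=; first exact: expand0.
by rewrite expandD expandZ IH.
Qed.

Let expand_contract (z : I) (h : seq V -> K) u :
  expand (contract C (re z) h) u + j * expand (contract C (im z) h) u =
  contract expand_cov z (expand h) u.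
Proof.
elim: u h => [|y u IH] h /=; first by rewrite mulr0 addr0.
rewrite !expandD !expandZ contractD contractZ -!IH /expand_cov; ring.
Qed.

(** The recursion is multilinear in the letters, so it survives the passage to complex combinations,
    with the covariance extended bilinearly (not sesquilinearly). The open factors [u] are expanded
    too, because reading moves letters from [w] to [u]. *)
Lemma expand_wick u w :
  expand (fun r => expand (wick C g r) w) u = wick expand_cov (expand g) u w.
Proof.
elim: w u => [|z w IH] u //=.
rewrite -IH -(eq_contract _ _ _ IH) -expand_contract /=.
rewrite expandD expandZ.
rewrite (@eq_expand _ (fun r => expand (wick C g (re z :: r)) w +
  contract C (re z) (fun u' => expand (wick C g u') w) r)); last first.
  by move=> r; rewrite expandD contract_expand.
rewrite [X in _ + _ * X](@eq_expand _ (fun r => expand (wick C g (im z :: r)) w +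
  contract C (im z) (fun u' => expand (wick C g u') w) r)); last first.
  by move=> r; rewrite expandD contract_expand.
by rewrite !expandD; ring.
Qed.

End ComplexExpansion.

Lemma rmorph_wick (K L : comNzRingType) (f : {rmorphism K -> L}) (V : Type)
    (C : V -> V -> K) g u w :
  f (wick C g u w) = wick (fun x y => f (C x y)) (fun s => f (g s)) u w.
Proof.
have Hc x h s : f (contract C x h s) =
    contract (fun x y => f (C x y)) x (fun s => f (h s)) s.
  elim: s h => [|y s IH] h /=; first exact: rmorph0.
  by rewrite rmorphD rmorphM IH.
elim: w u => //= x w IH u.
by rewrite rmorphD IH Hc; congr (_ + _); apply: eq_contract.
Qed.

Lemma eq_wick_cov (K : comNzRingType) (V : Type) (C C' : V -> V -> K) g g' u w :
  C =2 C' -> g =1 g' -> wick C g u w = wick C' g' u w.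
Proof.
move=> CC' gg'.
have Hc x h s : contract C x h s = contract C' x h s.
  by elim: s h => //= y s IH h; rewrite IH CC'.
elim: w u => //= x w IH u.
by rewrite IH Hc; congr (_ + _); apply: eq_contract.
Qed.

(** * Expectations of complex random variables *)

Section ComplexIntegrable.
Context {R : realType} d {T : measurableType d} (P : probability T R).

Definition cintegrable (X : T -> R[i]) :=
  P.-integrable setT (EFin \o (fun t => complex.Re (X t))) /\
  P.-integrable setT (EFin \o (fun t => complex.Im (X t))).

Lemma cexpectationE (X : T -> R[i]) : cexpectation P X =
  ((\int[P]_t complex.Re (X t)) +i* (\int[P]_t complex.Im (X t)))%C.
Proof. by rewrite /cexpectation !unlock. Qed.

Lemma cintegrableD X Y : cintegrable X -> cintegrable Y ->
  cintegrable (fun t => X t + Y t).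
Proof.
move=> [X1 X2] [Y1 Y2]; split.
  have := integrableD measurableT X1 Y1; apply: eq_integrable => // t _ /=.
  by case: (X t) (Y t) => ? ? [].
have := integrableD measurableT X2 Y2; apply: eq_integrable => // t _ /=.
by case: (X t) (Y t) => ? ? [].
Qed.

Lemma cintegrableZ c X : cintegrable X -> cintegrable (fun t => c * X t).
Proof.
move=> [X1 X2]; case: c => a b; split.
  have := integrableB measurableT (integrableZl measurableT a X1)
    (integrableZl measurableT b X2).
  apply: eq_integrable => // t _ /=.
  by case: (X t) => ? ? /=; rewrite -!EFinM -EFinB.
have := integrableD measurableT (integrableZl measurableT a X2)
  (integrableZl measurableT b X1).
apply: eq_integrable => // t _ /=.
by case: (X t) => ? ? /=; rewrite -!EFinM -EFinD.
Qed.

Lemma cexpectationD X Y : cintegrable X -> cintegrable Y ->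
  cexpectation P (fun t => X t + Y t) = cexpectation P X + cexpectation P Y.
Proof.
move=> [X1 X2] [Y1 Y2]; rewrite !cexpectationE.
rewrite {1 2}/GRing.add /= /add; apply/eqP; rewrite eq_complex /=; apply/andP.
split; apply/eqP; rewrite -RintegralD//; apply: eq_Rintegral => t _.
  by case: (X t) (Y t) => ? ? [].
by case: (X t) (Y t) => ? ? [].
Qed.

Lemma cexpectationZ c X : cintegrable X ->
  cexpectation P (fun t => c * X t) = c * cexpectation P X.
Proof.
move=> [X1 X2]; rewrite !cexpectationE; case: c => a b.
apply/eqP; rewrite eq_complex /=; apply/andP; split; apply/eqP.
  rewrite -!RintegralZl// -RintegralB//; first last.
  - by have := integrableZl measurableT b X2; apply: eq_integrable => // t _; rewrite /= EFinM.
  - by have := integrableZl measurableT a X1; apply: eq_integrable => // t _; rewrite /= EFinM.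
  by apply: eq_Rintegral => t _; case: (X t).
rewrite -!RintegralZl// -RintegralD//; first last.
- by have := integrableZl measurableT b X1; apply: eq_integrable => // t _; rewrite /= EFinM.
- by have := integrableZl measurableT a X2; apply: eq_integrable => // t _; rewrite /= EFinM.
by apply: eq_Rintegral => t _; case: (X t).
Qed.

Lemma cexpectation_expand (I V : Type) (j : R[i]) (re im : I -> V)
    (g : T -> seq V -> R[i]) l : (forall s, cintegrable (g ^~ s)) ->
  cintegrable (fun t => expand j re im (g t) l) /\
  cexpectation P (fun t => expand j re im (g t) l) =
  expand j re im (fun s => cexpectation P (g ^~ s)) l.
Proof.
elim: l g => [|y l IH] g gi /=; first by split.
have [i1 e1] := IH (fun t s => g t (re y :: s)) (fun s => gi _).
have [i2 e2] := IH (fun t s => g t (im y :: s)) (fun s => gi _).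
split; first by apply: cintegrableD => //; exact: cintegrableZ.
rewrite cexpectationD//; last exact: cintegrableZ.
by rewrite cexpectationZ// e1 e2.
Qed.

End ComplexIntegrable.

(** * Wick's formula for the entries of a Gaussian matrix *)

Section GaussianMatrix.
Context {R : realType} d {T : measurableType d} (P : probability T R).
Variables (N : nat) (G : T -> 'M[R[i]]_N).
Hypotheses (N_gt0 : (0 < N)%N) (hG : gaussian_matrix P G).

Let x_ (p : 'I_N * 'I_N) w := complex.Re (G w p.1 p.2).
Let y_ (p : 'I_N * 'I_N) w := complex.Im (G w p.1 p.2).
Let D : {set 'I_N * 'I_N} := [set p : 'I_N * 'I_N | (p.1 <= p.2)%N]%SET.

Let GE w i j : G w i j = (x_ (i, j) w +i* y_ (i, j) w)%C.
Proof. by rewrite /x_ /y_ /=; case: (G w i j). Qed.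

Let y_diag i w : y_ (i, i) w = 0.
Proof.
have [/(_ i i w) + _ _ _ _] := hG; rewrite /y_ /=.
by case: (G w i i) => a b /= [e]; lra.
Qed.

Let entry_sym i j w : x_ (j, i) w = x_ (i, j) w /\ y_ (j, i) w = - y_ (i, j) w.
Proof.
have [/(_ i j w) + _ _ _ _] := hG; rewrite /x_ /y_ /= => ->.
by case: (G w j i) => a b /=; rewrite opprK.
Qed.

(** Variances of the real and the imaginary part. Off the diagonal, the vanishing expectation of the
    squared entry makes the two parts uncorrelated with equal shares of 1/N; on the diagonal the
    entry is real. *)
Let v1 (p : 'I_N * 'I_N) : R := if p.1 == p.2 then N%:R^-1 else N%:R^-1 / 2.
Let v2 (p : 'I_N * 'I_N) : R := if p.1 == p.2 then 0 else N%:R^-1 / 2.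

Let second_moment (i j : 'I_N) : (i <= j)%N ->
  \int[P]_w (x_ (i, j) w * x_ (i, j) w + y_ (i, j) w * y_ (i, j) w) = N%:R^-1.
Proof.
move=> ij; have [_ _ _ _ /(_ i j ij)[_ +]] := hG.
rewrite cexpectationE => /eqP; rewrite eq_complex => /andP[/eqP E _].
move: E; rewrite (_ : complex.Re (N%:R^-1 : R[i]) = N%:R^-1); last first.
  by rewrite -(rmorph_nat (real_complex R)) -fmorphV.
move=> <-; apply: eq_Rintegral => w _.
by rewrite normCK GE /=; ring.
Qed.

Let first_moment (i j : 'I_N) : (i <= j)%N ->
  \int[P]_w x_ (i, j) w = 0 /\ \int[P]_w y_ (i, j) w = 0.
Proof.
move=> ij; have [_ _ _ _ /(_ i j ij)[+ _]] := hG.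
by rewrite cexpectationE => /eqP; rewrite eq_complex => /andP[/eqP ? /eqP ?].
Qed.

Let off_diag_gaussian (i j : 'I_N) : (i < j)%N -> forall a b : R,
  real_gaussian P (fun w => a * x_ (i, j) w + b * y_ (i, j) w).
Proof. by move=> ij a b; have [_ _ /(_ i j ij)[+ _] _ _] := hG; apply. Qed.

Let diag_gaussian i : real_gaussian P (x_ (i, i)).
Proof. by have [_ _ _ + _] := hG; apply. Qed.

Let off_diag_x (i j : 'I_N) : (i < j)%N -> real_gaussian P (x_ (i, j)).
Proof.
move=> ij; have := off_diag_gaussian ij 1 0.
by congr real_gaussian; apply/funext => w; ring.
Qed.

Let off_diag_y (i j : 'I_N) : (i < j)%N -> real_gaussian P (y_ (i, j)).
Proof.
move=> ij; have := off_diag_gaussian ij 0 1.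
by congr real_gaussian; apply/funext => w; ring.
Qed.

Let mx_ p : p \in D -> measurable_fun setT (x_ p).
Proof.
case: p => i j; rewrite inE /= leq_eqVlt => /orP[/eqP/val_inj <-|ij].
  by have [] := diag_gaussian i.
by have [] := off_diag_x ij.
Qed.

Let my_ p : p \in D -> measurable_fun setT (y_ p).
Proof.
case: p => i j; rewrite inE /= leq_eqVlt => /orP[/eqP/val_inj <-|ij].
  by rewrite (_ : y_ _ = cst 0); [exact: measurable_cst|apply/funext => w; exact: y_diag].
by have [] := off_diag_y ij.
Qed.

Let entry_mgf p : p \in D -> forall a b : R,
  (\int[P]_w (expR (a * x_ p w + b * y_ p w))%:E =
   (expR ((v1 p * a ^+ 2 + v2 p * b ^+ 2) / 2))%:E)%E.
Proof.
case: p => i j; rewrite inE /= leq_eqVlt => /orP[/eqP/val_inj <-|ij] a b.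
  have [_ i2 H] := real_gaussian_moments (diag_gaussian i).
  have E1 := (first_moment (leqnn i)).1.
  have E2 : \int[P]_w (x_ (i, i) w * x_ (i, i) w) = 0 ^+ 2 + N%:R^-1.
    rewrite expr0n add0r -(second_moment (leqnn i)); apply: eq_Rintegral => w _.
    by rewrite y_diag; ring.
  have := H _ _ E1 E2 a.
  under eq_integral => w _ do rewrite (_ : a * _ = a * x_ (i, i) w + b * y_ (i, i) w) ?y_diag ?mulr0 ?addr0//.
  under [in X in _ -> X]eq_integral => w _ do rewrite y_diag mulr0 addr0.
  move=> ->; congr (expR _)%:E; rewrite /v1 /v2 /= eqxx; ring.
have ne : (i == j) = false by apply/negbTE; rewrite neq_ltn ij.
set X := x_ (i, j); set Y := y_ (i, j).
have [iX iXX _] := real_gaussian_moments (off_diag_x ij).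
have [iY iYY _] := real_gaussian_moments (off_diag_y ij).
have [_ iS _] := real_gaussian_moments (off_diag_gaussian ij 1 1).
have mT : measurable (setT : set T) by [].
(* Polarization: [2 * X * Y] is the square of [X + Y], a Gaussian variable, minus the squares of [X]
   and [Y]. *)
have iXY : P.-integrable setT (EFin \o (fun w => X w * Y w)).
  have := integrableZl mT (2^-1) (integrableB mT iS (integrableD mT iXX iYY)).
  apply: eq_integrable => // w _ /=.
  by rewrite -?EFinN -?EFinD -?EFinN -?EFinD -?EFinM; congr EFin; rewrite -/X -/Y; field.
have [_ _ /(_ i j ij)[_ +] _ _] := hG.
rewrite cexpectationE => /eqP; rewrite eq_complex /= => /andP[/eqP Ere /eqP Eim].
have ERe : \int[P]_w (X w * X w) = \int[P]_w (Y w * Y w).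
  apply/eqP; rewrite -subr_eq0 -RintegralB//; apply/eqP; rewrite -[RHS]Ere.
  by apply: eq_Rintegral => w _; rewrite GE expr2.
have EIm : \int[P]_w (X w * Y w) = 0.
  have : 2 * \int[P]_w (X w * Y w) = 0.
    rewrite -RintegralZl// -[RHS]Eim; apply: eq_Rintegral => w _.
    by rewrite GE expr2 /= -/X -/Y; ring.
  lra.
have EXY : \int[P]_w (X w * X w) = N%:R^-1 / 2.
  have := second_moment (ltnW ij); rewrite RintegralD// -/X -/Y -ERe; lra.
have [EX EY] := first_moment (ltnW ij).
have iZ (c : R) (f : T -> R) : P.-integrable setT (EFin \o f) ->
    P.-integrable setT (EFin \o (fun w => c * f w)).
  move=> /(integrableZl mT c); exact: eq_integrable.
have iD (f g : T -> R) : P.-integrable setT (EFin \o f) ->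
    P.-integrable setT (EFin \o g) ->
    P.-integrable setT (EFin \o (fun w => f w + g w)).
  by move=> fi gi; have := integrableD mT fi gi; apply: eq_integrable.
have [_ _ H] := real_gaussian_moments (off_diag_gaussian ij a b).
have E1 : \int[P]_w (a * X w + b * Y w) = 0.
  by rewrite RintegralD ?RintegralZl ?EX ?EY ?mulr0 ?addr0//; exact: iZ.
have E2 : \int[P]_w ((a * X w + b * Y w) * (a * X w + b * Y w)) =
    0 ^+ 2 + (a ^+ 2 + b ^+ 2) * (N%:R^-1 / 2).
  transitivity (\int[P]_w ((a ^+ 2 * (X w * X w) + b ^+ 2 * (Y w * Y w)) +
                            2 * a * b * (X w * Y w))).
    by apply: eq_Rintegral => w _; ring.
  rewrite RintegralD//; [|by apply: iD; exact: iZ|exact: iZ].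
  rewrite RintegralD//; [|exact: iZ|exact: iZ].
  by rewrite !RintegralZl// EIm -ERe EXY; ring.
have := H _ _ E1 E2 1.
under eq_integral do rewrite mul1r.
move=> ->; congr (expR _)%:E; rewrite /v1 /v2 /= ne; ring.
Qed.

(** Coefficients of the real parts and of the imaginary parts. Only the independent entries, those
    in [D], span the process. *)
Let U : lmodType R := ({ffun 'I_N * 'I_N -> R^o} * {ffun 'I_N * 'I_N -> R^o})%type.
Let xi (u : U) w := \sum_(p in D) (u.1 p * x_ p w + u.2 p * y_ p w).
Let C (u v : U) := \sum_(p in D) (v1 p * u.1 p * v.1 p + v2 p * u.2 p * v.2 p).

Let mxi u : measurable_fun setT (xi u).
Proof.
rewrite /xi; under eq_fun do rewrite -big_filter.
have : all (mem D) [seq p <- index_enum _ | p \in D] by exact: filter_all.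
elim: [seq p <- _ | _] => [_|p s IH /= /andP[pD sD]].
  by under eq_fun do rewrite big_nil; exact: measurable_cst.
under eq_fun do rewrite big_cons; apply: measurable_funD; last exact: IH.
by apply: measurable_funD; apply: measurable_funM => //; [exact: mx_|exact: my_].
Qed.

Let xiP (a : R) (u v : U) t : xi (a *: u + v) t = a * xi u t + xi v t.
Proof.
rewrite /xi mulr_sumr -big_split; apply: eq_bigr => p _ /=.
by rewrite !ffunE /GRing.scale/=; ring.
Qed.

Let CP (a : R) (u v w : U) : C (a *: u + v) w = a * C u w + C v w.
Proof.
rewrite /C mulr_sumr -big_split; apply: eq_bigr => p _ /=.
by rewrite !ffunE /GRing.scale/=; ring.
Qed.

Let CC u v : C u v = C v u.
Proof. by apply: eq_bigr => p _; ring. Qed.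

Let mgf u : (\int[P]_t (expR (xi u t))%:E = (expR (0 + C u u / 2))%:E)%E.
Proof.
have [_ indep _ _ _] := hG.
rewrite add0r.
pose phi (p : 'I_N * 'I_N) (z : R * R) := expR (u.1 p * z.1 + u.2 p * z.2).
transitivity (\int[P]_t (\prod_(p in D) phi p (complex_coords (G t p.1 p.2)))%:E)%E.
  by apply: eq_integral => t _; rewrite /xi expR_sum.
rewrite (@independent_prod_integral _ _ _ P _ D (fun p w => G w p.1 p.2) _ indep phi
  (fun p => expR ((v1 p * u.1 p ^+ 2 + v2 p * u.2 p ^+ 2) / 2))).
- rewrite -expR_sum /C mulr_suml; congr (expR _)%:E.
  by apply: eq_bigr => p _; ring.
- by move=> p pD; apply/measurable_fun_pairP; split; [exact: mx_|exact: my_].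
- move=> p pD; apply: measurableT_comp => //.
  by apply: measurable_funD; apply: measurable_funM.
- by move=> p z; exact: expR_ge0.
- by move=> p pD; exact: (entry_mgf pD (u.1 p) (u.2 p)).
Qed.

(** An entry below the diagonal is the conjugate of its mirror image: same real part, opposite
    imaginary part, hence the sign [sg]. *)
Let s_ (p : 'I_N * 'I_N) := if (p.1 <= p.2)%N then p else (p.2, p.1).
Let sg (p : 'I_N * 'I_N) : R := if (p.1 <= p.2)%N then 1 else -1.
Let re p : U := ([ffun q => (q == s_ p)%:R], 0).
Let im p : U := (0, [ffun q => sg p * (q == s_ p)%:R]).

Let s_D p : s_ p \in D.
Proof.
rewrite /s_; case: leqP => [|/ltnW]; rewrite inE //.
Qed.

Let xi_re p w : xi (re p) w = x_ p w.
Proof.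
rewrite /xi (bigD1 (s_ p))//= !ffunE eqxx big1 => [|q /andP[_ /negPf qs]]; last first.
  by rewrite !ffunE qs !mul0r addr0.
rewrite mul1r mul0r !addr0 /s_; case: ifP => // _.
by case: p => i j; exact: (entry_sym i j w).1.
Qed.

Let xi_im p w : xi (im p) w = y_ p w.
Proof.
rewrite /xi (bigD1 (s_ p))//= !ffunE eqxx big1 => [|q /andP[_ /negPf qs]]; last first.
  by rewrite !ffunE qs mulr0 !mul0r addr0.
rewrite mulr1 mul0r add0r addr0 /s_ /sg; case: ifP => _; first by rewrite mul1r.
by case: p => i j; rewrite /= (entry_sym i j w).2 mulrN mulN1r opprK.
Qed.

Let cov_im_re p q : C (im p) (re q) = 0.
Proof. by rewrite /C big1// => r _; rewrite !ffunE; ring. Qed.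

Let cov_re_re p q : C (re p) (re q) = v1 (s_ p) * (s_ p == s_ q)%:R.
Proof.
rewrite /C (bigD1 (s_ p))//= !ffunE eqxx big1 => [|r /andP[_ /negPf rs]]; last first.
  by rewrite !ffunE rs /=; ring.
by rewrite /=; ring.
Qed.

Let cov_im_im p q : C (im p) (im q) = v2 (s_ p) * sg p * sg q * (s_ p == s_ q)%:R.
Proof.
rewrite /C (bigD1 (s_ p))//= !ffunE eqxx big1 => [|r /andP[_ /negPf rs]]; last first.
  by rewrite !ffunE rs /=; ring.
by rewrite /=; ring.
Qed.

(** Off the diagonal, the two variances cancel when [q = p] and add up to 1/N when [q] is the
    transpose of [p]. *)
Let cov_entries p q :
  C (re p) (re q) - C (im p) (im q) = (q == (p.2, p.1))%:R / N%:R.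
Proof.
rewrite cov_re_re cov_im_im /v1 /v2 /s_ /sg.
case: p q => [i j] [k l] /=.
case: (ltngtP i j) => [ij|ij|/val_inj <-]; case: (ltngtP k l) => [kl|kl|/val_inj <-] //=;
  rewrite ?eqxx ?xpair_eqE -?val_eqE /=;
  do ?[case: eqP => ? /=]; try (exfalso; lia); try ring; try lra.
Qed.

Lemma gaussian_matrix_wick l :
  cintegrable P (fun w => \prod_(p <- l) G w p.1 p.2) /\
  cexpectation P (fun w => \prod_(p <- l) G w p.1 p.2) =
  wick (fun p q => (q == (p.2, p.1))%:R / N%:R) (fun u => (nilp u)%:R) [::] l.
Proof.
have M0 (a : R) (u v : U) : (fun _ : U => 0 : R) (a *: u + v) =
  a * (fun _ : U => 0) u + (fun _ : U => 0) v by rewrite mulr0 addr0.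
have int := gaussian_moment_integrable mxi xiP mgf.
have E := gaussian_wick mxi xiP M0 CP CC mgf.
pose g w (s : seq U) : R[i] := real_complex R (\prod_(x <- s) xi x w).
have gi s : cintegrable P (g ^~ s).
  split; first exact: int.
  by rewrite /g /=; exact: integrable0.
have [Ei Ee] := cexpectation_expand 'i%C re im l gi.
have -> : (fun w => \prod_(p <- l) G w p.1 p.2) =
    (fun w => expand 'i%C re im (g w) l).
  apply/funext => w.
  have -> : expand 'i%C re im (g w) l =
      expand 'i%C re im (fun s => \prod_(x <- s) real_complex R (xi x w)) l.
    by apply: eq_expand => s; rewrite /g rmorph_prod.
  rewrite expand_prod; apply: eq_bigr => p _.
  rewrite xi_re xi_im GE; case: p => i j /=.
  by apply/eqP; rewrite eq_complex /=; apply/andP; split; apply/eqP; ring.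
split=> //; rewrite Ee; pose C' x y := real_complex R (C x y).
pose h (u : seq U) : R[i] := real_complex R (\prod_(x <- u) 0).
rewrite (@eq_expand _ _ _ _ _ _ _ (fun s => wick C' h [::] s)); last first.
  move=> s; rewrite -rmorph_wick -E cexpectationE /g /=.
  by rewrite Rintegral_cst// mul0r.
rewrite -[LHS]/(expand 'i%C re im (fun r => expand 'i%C re im (wick C' h r) l) [::]).
rewrite expand_wick; apply: eq_wick_cov => [p q|u].
  rewrite /expand_cov /C' (CC (re p) (im q)) !cov_im_re.
  transitivity (real_complex R (C (re p) (re q) - C (im p) (im q))).
    by apply/eqP; rewrite eq_complex /=; apply/andP; split; apply/eqP; ring.
  rewrite cov_entries rmorphM /= fmorphV !rmorph_nat //.
(* The means are 0, so the terminal value is an empty product or 0: only complete contractions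
   survive. *)
rewrite /h (@eq_expand _ _ _ _ _ _ _ (fun s => \prod_(x <- s) (fun=> 0) x)); last first.
  by move=> s; rewrite rmorph_prod; apply: eq_bigr => x _; rewrite rmorph0.
rewrite expand_prod; case: u => [|p u]; first by rewrite big_nil.
by rewrite big_cons mulr0 addr0 mul0r.
Qed.

End GaussianMatrix.

(** * Sums over paths and their size *)

Lemma transp_swap N (p : 'I_N * 'I_N) : (p.2, p.1) = transp N p.
Proof. by case: p => i j; rewrite transpE. Qed.

Section PathSums.
Variables (R : realType) (L : eqType) (N : nat) (tau : L -> entry_perm N).
Hypothesis N_gt0 : (0 < N)%N.

Notation pts := ('I_N * 'I_N)%type.
Notation Nr := (N%:R : R).

Definition entry_cov (K : unitRingType) (p q : pts) : K :=
  (q == (p.2, p.1))%:R / N%:R.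

(* Sum of the Wick sums of the entries read along all paths from [v] to [v0]
   that follow the word [w]; the entries in [u] were read before. *)
Fixpoint path_sum (u : seq pts) (w : seq L) (v v0 : 'I_N) : R :=
  if w is x :: w' then
    \sum_v' (path_sum (tau x (v, v') :: u) w' v' v0 +
      contract (@entry_cov R) (tau x (v, v')) (fun u' => path_sum u' w' v' v0) u)
  else (nilp u && (v == v0))%:R.

(* Sum over the paths that follow the open letters [xs], listed most recent
   first; [F] receives the entries read, the current and the initial vertex. *)
Fixpoint open_sum (xs : seq L) (F : seq pts -> 'I_N -> 'I_N -> R) : R :=
  if xs is x :: xs' then
    open_sum xs' (fun u v v0 => \sum_v' F (tau x (v, v') :: u) v' v0)
  else \sum_v F [::] v v.

(** Counts the ways to read [n] letters with [k] open ones, each letter being opened or contracted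
    with an open one. Readings that end with open letters are counted as well, which is enough for
    an upper bound. *)
Fixpoint path_bound (k n : nat) : R :=
  if n is n'.+1 then path_bound k.+1 n' + k%:R * path_bound k.-1 n' else 1.

Lemma path_bound_ge0 k n : 0 <= path_bound k n.
Proof. by elim: n k => //= n IH k; rewrite addr_ge0 ?mulr_ge0. Qed.

Let Nr_gt0 : 0 < Nr. Proof. by rewrite ltr0n. Qed.

Let Nr_neq0 : Nr != 0. Proof. by rewrite gt_eqF. Qed.

Lemma contract_ge0 p (g : seq pts -> R) u : (forall r, 0 <= g r) ->
  0 <= contract (@entry_cov R) p g u.
Proof.
elim: u g => //= q u IH g g0; rewrite addr_ge0// ?IH// ?mulr_ge0 ?ler0n ?invr_ge0 ?ler0n ?g0//.
Qed.

Lemma path_sum_ge0 u w v v0 : 0 <= path_sum u w v v0.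
Proof.
elim: w u v => [|x w IH] u v //=.
by apply: sumr_ge0 => v' _; rewrite addr_ge0 ?contract_ge0.
Qed.

(** An open entry is the transpose of [f a] for at most one [a], so the sum over [A] costs no factor
    [#|A|]. *)
Lemma sum_contract_le (A : finType) (f : A -> pts) (g : A -> seq pts -> R) b u :
  injective f -> 0 <= b -> (forall a r, 0 <= g a r) ->
  (forall a r, (size r).+1 = size u -> g a r <= b) ->
  \sum_a contract (@entry_cov R) (f a) (g a) u <= (size u)%:R * b / Nr.
Proof.
move=> finj b_ge0 g0; elim: u g g0 => [|q u IH] g g0 gb /=.
  by rewrite big1 ?mul0r.
rewrite big_split /= -natr1 2!mulrDl addrC mul1r; apply: lerD.
  apply: IH => [a r|a r sr]; first exact: g0.
  by apply: gb; rewrite /= sr.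
have b0 : \sum_a (f a == (q.2, q.1))%:R * g a u <= b.
  have [[a fa]|nf] := pselect (exists a, f a = (q.2, q.1)).
    rewrite (bigD1 a)//= fa eqxx mul1r big1 ?addr0 ?gb// => a' aa'.
    by rewrite -fa (inj_eq finj) (negPf aa') mul0r.
  rewrite big1// => a _; case: eqP => fa; last by rewrite mul0r.
  by case: nf; exists a.
under eq_bigr do rewrite /entry_cov mulrAC.
by rewrite -mulr_suml ler_pM2r// invr_gt0.
Qed.

(** Opening a letter gives N choices of the next vertex, offset by one more open letter. Contracting
    it determines the next vertex and gives 1/N, which makes up for the loss of an open letter. *)
Lemma path_sum_le u w v v0 :
  path_sum u w v v0 <= path_bound (size u) (size w) / Nr ^+ size u.
Proof.
elim: w u v => [|x w IH] u v /=.
  case: u => [|q u] /=; first by rewrite expr0 divr1; case: eqP.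
  by rewrite divr_ge0 ?exprn_ge0 ?ltW.
have tinj : injective (fun v' => tau x (v, v')).
  by move=> a b /perm_inj [].
rewrite big_split mulrDl /=; apply: lerD.
  apply: (@le_trans _ _ (\sum_(v' < N) path_bound (size u).+1 (size w) / Nr ^+ (size u).+1)).
    by apply: ler_sum => v' _; exact: IH.
  rewrite sumr_const card_ord -mulr_natr exprS le_eqVlt; apply/orP; left.
  by apply/eqP; field; rewrite mul1r Nr_neq0 expf_neq0.
have := @sum_contract_le _ (fun v' => tau x (v, v'))
  (fun v' u' => path_sum u' w v' v0)
  (path_bound (size u).-1 (size w) / Nr ^+ (size u).-1) u tinj.
case: u => [|q u] /=; first by rewrite big1// => _; rewrite !mul0r.
move=> H; apply: le_trans (H _ _ _) _.
- by rewrite divr_ge0 ?path_bound_ge0 ?exprn_ge0 ?ltW.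
- by move=> a r; exact: path_sum_ge0.
- by move=> a r [<-]; exact: IH.
by rewrite exprS invfM !mulrA mulrAC.
Qed.

Lemma open_sum_le xs F F' :
  (forall u v v0, size u = size xs -> F u v v0 <= F' u v v0) ->
  open_sum xs F <= open_sum xs F'.
Proof.
elim: xs F F' => [|x xs IH] F F' FF' /=.
  by apply: ler_sum => v _; exact: FF'.
by apply: IH => u v v0 su; apply: ler_sum => v' _; apply: FF'; rewrite /= su.
Qed.

Lemma open_sum_eq xs F F' :
  (forall u v v0, size u = size xs -> F u v v0 = F' u v v0) ->
  open_sum xs F = open_sum xs F'.
Proof.
by move=> FF'; apply/eqP; rewrite eq_le !open_sum_le// => u v v0 su; rewrite FF'.
Qed.

Lemma open_sumD xs F F' :
  open_sum xs (fun u v v0 => F u v v0 + F' u v v0) =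
  open_sum xs F + open_sum xs F'.
Proof.
elim: xs F F' => [|x xs IH] F F' /=; first by rewrite big_split.
by rewrite -IH; apply: open_sum_eq => u v v0 _; rewrite big_split.
Qed.

Lemma open_sum_current xs (f : 'I_N -> R) :
  open_sum xs (fun _ v _ => f v) = Nr ^+ size xs * \sum_v f v.
Proof.
elim: xs f => [|x xs IH] f /=; first by rewrite mul1r.
rewrite (IH (fun=> \sum_v' f v')) sumr_const card_ord exprS.
by rewrite -[X in _ * X = _]mulr_natl; ring.
Qed.

Definition stack_path_sum xs w := open_sum xs (fun u v v0 => path_sum u w v v0).

(** With [a.1 = (v, v1)] and [a.2 = v']: the paths from [v] through [v1] to [v'] on which [y] and
    then [x] read transposed, hence correlated, entries. *)
Definition meeting_count (y x : L) : nat :=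
  #|[set a : 'I_N * 'I_N * 'I_N |
      tau x (a.1.2, a.2) == transp N (tau y a.1)]%SET|.

Lemma stack_path_sum_nil xs : stack_path_sum xs [::] = (nilp xs)%:R * Nr.
Proof.
rewrite /stack_path_sum; case: xs => [|x xs] /=.
  by under eq_bigr do rewrite eqxx; rewrite sumr_const card_ord mul1r.
rewrite (@open_sum_eq _ _ (fun _ _ _ => 0)); last by move=> u v v0 _; rewrite big1.
by rewrite (open_sum_current _ (fun=> 0)) big1// mulr0 mul0r.
Qed.

Lemma stack_path_sum_open x w : stack_path_sum [::] (x :: w) = stack_path_sum [:: x] w.
Proof. by rewrite /stack_path_sum /=; apply: eq_bigr => v _; apply: eq_bigr => v' _; rewrite addr0. Qed.

(* In [close_inner] the letter [x] is contracted with an open letter other than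
   the last one, [y]; this fixes both [v1] and [v'], and costs a factor [N]. *)
Let close_last y x w u v v0 : R :=
  \sum_v1 \sum_v' entry_cov R (tau y (v, v1)) (tau x (v1, v')) * path_sum u w v' v0.

Let close_inner y x w u v v0 : R :=
  \sum_v1 \sum_v' contract (@entry_cov R) (tau x (v1, v'))
    (fun u' => path_sum (tau y (v, v1) :: u') w v' v0) u.

Let stack_path_sum_cons y xs x w : stack_path_sum (y :: xs) (x :: w) =
  stack_path_sum (x :: y :: xs) w + open_sum xs (close_last y x w)
  + open_sum xs (close_inner y x w).
Proof.
rewrite /stack_path_sum /= -!open_sumD; apply: open_sum_eq => u v v0 _.
rewrite /close_last /close_inner -!big_split /=; apply: eq_bigr => v1 _.
by rewrite -!big_split /=; apply: eq_bigr => v' _; rewrite addrA.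
Qed.

(** The open vertices give [N ^ (size xs).+1]; this is cancelled by [N ^- size xs] from
    [path_sum_le] and by the covariance 1/N. The result is O(1), against leading terms of order
    N. *)
Let close_inner_bound y xs x w :
  0 <= open_sum xs (close_inner y x w) <=
  (size xs)%:R * path_bound (size xs) (size w).
Proof.
have h0 u v v0 : 0 <= close_inner y x w u v v0.
  apply: sumr_ge0 => v1 _; apply: sumr_ge0 => v' _.
  by apply: contract_ge0 => r; exact: path_sum_ge0.
apply/andP; split.
  apply: (@le_trans _ _ (open_sum xs (fun _ _ _ => 0))).
    by rewrite (open_sum_current _ (fun=> 0)) big1// mulr0.
  by apply: open_sum_le.
set K := path_bound _ _; pose k := size xs.
apply: (@le_trans _ _ (open_sum xs (fun _ _ _ => k%:R * (K / Nr ^+ k) / Nr))).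
  apply: open_sum_le => u v v0 su; rewrite /close_inner pair_bigA /=.
  rewrite /k -su; apply: (@sum_contract_le _ (fun a => tau x (a.1, a.2))).
  - by move=> [a1 a2] [b1 b2] /perm_inj [-> ->].
  - by rewrite divr_ge0 ?path_bound_ge0 ?exprn_ge0 ?ltW.
  - by move=> a r; exact: path_sum_ge0.
  - move=> [a1 a2] r sr; apply: le_trans (path_sum_le _ _ _ _) _.
    by rewrite /= sr /K su.
rewrite (open_sum_current _ (fun=> _)) sumr_const card_ord -/k.
rewrite -mulr_natr. rewrite le_eqVlt; apply/orP; left; apply/eqP.
by field; rewrite ?mul1r Nr_neq0 expf_neq0.
Qed.

(** The contraction forces the path to backtrack, [v' = v]. The middle vertex [v1] stays free, and
    its N values cancel the covariance 1/N. *)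
Let close_last_compat y x xs w : tau x = conj_transp (tau y) ->
  open_sum xs (close_last y x w) = stack_path_sum xs w.
Proof.
move=> xy; apply: open_sum_eq => u v v0 _; rewrite /close_last.
transitivity (\sum_(v1 < N) Nr^-1 * path_sum u w v v0); last first.
  by rewrite sumr_const card_ord -[LHS]mulr_natl mulrA mulfV// mul1r.
apply: eq_bigr => v1 _; rewrite (bigD1 v)//= big1 => [|v' v'v].
  by rewrite /entry_cov xy conj_transpE transpE transp_swap eqxx mul1r addr0.
rewrite /entry_cov xy conj_transpE transpE transp_swap.
by rewrite !(inj_eq perm_inj) xpair_eqE (negPf v'v) mul0r mul0r.
Qed.

(** The vertices before [v] are free and give [N ^ size xs], which cancels the bound of
    [path_sum_le]. There remains the number of meeting paths times the covariance 1/N, hence o(N)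
    when that number is o(N^2). *)
Let close_last_bound y x xs w :
  0 <= open_sum xs (close_last y x w) <=
  path_bound (size xs) (size w) * (meeting_count y x)%:R / Nr.
Proof.
have h0 u v v0 : 0 <= close_last y x w u v v0.
  apply: sumr_ge0 => v1 _; apply: sumr_ge0 => v' _.
  by rewrite mulr_ge0 ?path_sum_ge0// divr_ge0.
apply/andP; split.
  apply: (@le_trans _ _ (open_sum xs (fun _ _ _ => 0))).
    by rewrite (open_sum_current _ (fun=> 0)) big1// mulr0.
  by apply: open_sum_le.
set K := path_bound _ _; pose k := size xs.
pose e v v1 v' : R := entry_cov R (tau y (v, v1)) (tau x (v1, v')).
apply: (@le_trans _ _ (open_sum xs (fun _ v _ =>
    \sum_v1 \sum_v' e v v1 v' * (K / Nr ^+ k)))).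
  apply: open_sum_le => u v v0 su; apply: ler_sum => v1 _; apply: ler_sum => v' _.
  apply: ler_wpM2l; first by rewrite divr_ge0.
  by rewrite /K /k -su; exact: path_sum_le.
rewrite (open_sum_current _ (fun v => \sum_v1 \sum_v' e v v1 v' * (K / Nr ^+ k))).
have -> : \sum_v \sum_v1 \sum_v' e v v1 v' * (K / Nr ^+ k) =
    (meeting_count y x)%:R / Nr * (K / Nr ^+ k).
  rewrite pair_bigA /= pair_bigA /= -mulr_suml; congr (_ * _).
  rewrite /meeting_count -sum1_card natr_sum mulr_suml [in RHS]big_mkcond /=.
  apply: eq_bigr => -[[v v1] v'] _; rewrite inE /= /e /entry_cov transp_swap.
  by case: eqP; rewrite ?mul0r.
rewrite le_eqVlt; apply/orP; left; apply/eqP; rewrite -/k.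
by field; rewrite ?mul1r Nr_neq0 expf_neq0.
Qed.

Lemma stack_path_sum_compat y xs x w : tau x = conj_transp (tau y) ->
  0 <= stack_path_sum (y :: xs) (x :: w)
       - (stack_path_sum (x :: y :: xs) w + stack_path_sum xs w) <=
  (size xs)%:R * path_bound (size xs) (size w).
Proof.
move=> xy; rewrite stack_path_sum_cons close_last_compat//.
by rewrite (addrC _ (open_sum xs (close_inner _ _ _))) addrK close_inner_bound.
Qed.

Lemma stack_path_sum_incompat y xs x w :
  0 <= stack_path_sum (y :: xs) (x :: w) - stack_path_sum (x :: y :: xs) w <=
  path_bound (size xs) (size w) * (meeting_count y x)%:R / Nr +
  (size xs)%:R * path_bound (size xs) (size w).
Proof.
rewrite stack_path_sum_cons [X in 0 <= X <= _](_ : _ =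
  open_sum xs (close_last y x w) + open_sum xs (close_inner y x w)); last by ring.
have /andP[a0 ab] := close_last_bound y x xs w.
have /andP[b0 bb] := close_inner_bound y xs x w.
by rewrite addr_ge0//= lerD.
Qed.

End PathSums.

(** The stack holds the adjoints of the open letters, so that a letter may close the top exactly
    when it equals it. *)
Fixpoint stack_count (L : eqType) (st : L -> L) (w u : seq L) : nat :=
  if w is x :: w' then
    stack_count st w' (st x :: u) +
    (if u is y :: u' then (x == y) * stack_count st w' u' else 0)
  else nilp u.

(** * The limit of the path sums *)

Section PathLimit.
Variables (R : realType) (L : eqType) (st : L -> L).
Variable tau : L -> forall N, entry_perm N.
Hypothesis compat : forall x N, tau (st x) N = conj_transp (tau x N).
Hypothesis incompat : forall y x, x != st y ->
  is_o_square R (fun N => meeting_count (tau ^~ N) y x).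

Let o_square_cvg (u : nat -> nat) : is_o_square R u ->
  (u n.+1)%:R / n.+1%:R ^+ 2 @[n --> \oo] --> (0 : R).
Proof.
move=> /eqoP uo; apply/cvgrPdist_le => /= e e0.
have [n _ H] := uo _ e0; exists n => // m /= nm.
rewrite sub0r normrN normrM normfV ler_pdivrMr ?normr_gt0 ?expf_neq0 ?pnatr_eq0//.
exact: H m.+1 (leqW nm).
Qed.

Let cvg_inv : (n.+1%:R : R)^-1 @[n --> \oo] --> (0 : R).
Proof. exact: cvg_harmonic. Qed.

(** Reading a letter changes the stack, so the induction on [w] is over all stacks. [map st] appears
    because [stack_count] stores adjoints. *)
Lemma stack_path_sum_cvg xs w :
  stack_path_sum R (tau ^~ n.+1) xs w / n.+1%:R @[n --> \oo] -->
  ((stack_count st w (map st xs))%:R : R).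
Proof.
elim: w xs => [|x w IH] xs.
  under eq_fun do rewrite stack_path_sum_nil mulfK ?pnatr_eq0//.
  by rewrite /= /nilp size_map; exact: cvg_cst.
case: xs => [|y xs].
  under eq_fun do rewrite stack_path_sum_open.
  by rewrite /= addn0; exact: (IH [:: x]).
pose s n := stack_path_sum R (tau ^~ n.+1) (y :: xs) (x :: w).
pose s1 n := stack_path_sum R (tau ^~ n.+1) (x :: y :: xs) w.
pose s2 n := (x == st y)%:R * stack_path_sum R (tau ^~ n.+1) xs w.
pose K := path_bound R (size xs) (size w).
(* The error bounds of [stack_path_sum_compat] and [stack_path_sum_incompat] in one formula, divided
   by N: the meeting term is thereby divided by N^2 in total. *)
pose b n := (x != st y)%:R * K * ((meeting_count (tau ^~ n.+1) y x)%:R / n.+1%:R ^+ 2)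
   + (size xs)%:R * K * n.+1%:R^-1.
have K0 : 0 <= K by exact: path_bound_ge0.
have sb n : 0 <= s n / n.+1%:R - (s1 n / n.+1%:R + s2 n / n.+1%:R) <= b n.
  rewrite -mulrDl -mulrBl /s /s1 /s2 /b.
  have n0 : (n.+1%:R : R) != 0 by rewrite pnatr_eq0.
  have [xy|xy] := eqVneq x (st y).
    have /andP[h1 h2] := @stack_path_sum_compat R L n.+1 (tau ^~ n.+1) isT y xs x w
      (etrans (congr1 (tau ^~ n.+1) xy) (compat y n.+1)).
    rewrite mul1r !mul0r add0r divr_ge0//=.
    by apply: ler_wpM2r; rewrite ?invr_ge0.
  have /andP[h1 h2] := @stack_path_sum_incompat R L n.+1 (tau ^~ n.+1) isT y xs x w.
  rewrite mul0r mul1r addr0 divr_ge0//=.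
  rewrite ler_pdivrMr ?ltr0n//; apply: le_trans h2 _; rewrite -/K.
  by rewrite le_eqVlt; apply/orP; left; apply/eqP; field.
have b0 : b n @[n --> \oo] --> (0 : R).
  rewrite -[0](addr0 0); apply: cvgD.
    have [xy|xy] := eqVneq x (st y).
      by under eq_fun do rewrite /= !mul0r; exact: cvg_cst.
    rewrite -(mulr0 (true%:R * K)); apply: cvgMr.
    exact: o_square_cvg (incompat xy).
  by rewrite -(mulr0 ((size xs)%:R * K)); apply: cvgMr; exact: cvg_inv.
have d0 : (s n / n.+1%:R - (s1 n / n.+1%:R + s2 n / n.+1%:R)) @[n --> \oo] --> (0 : R).
  by apply: (squeeze_cvgr _ (cvg_cst 0) b0); apply: nearW.
have c12 : (s1 n / n.+1%:R + s2 n / n.+1%:R) @[n --> \oo] -->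
   ((stack_count st (x :: w) (map st (y :: xs)))%:R : R).
  rewrite /= natrD; apply: cvgD; first exact: (IH (x :: y :: xs)).
  rewrite natrM /s2; under eq_fun do rewrite -mulrA.
  by apply: cvgMr; exact: IH.
have -> : (fun n => stack_path_sum R (tau ^~ n.+1) (y :: xs) (x :: w) / n.+1%:R) =
    (fun n => s n / n.+1%:R - (s1 n / n.+1%:R + s2 n / n.+1%:R)) +
    (fun n => s1 n / n.+1%:R + s2 n / n.+1%:R).
  by apply/funext => n; rewrite fctE subrK.
by rewrite -[X in _ --> X]add0r; exact: cvgD.
Qed.

End PathLimit.

(** * Traces of products as sums over paths *)

Section PathExpansion.
Variables (L : eqType) (N : nat) (tau : L -> entry_perm N).

Fixpoint path_expand (K : pzRingType) (F : seq ('I_N * 'I_N) -> K) (w : seq L)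
    (v v0 : 'I_N) : K :=
  if w is x :: w' then
    \sum_v' path_expand (fun s => F (tau x (v, v') :: s)) w' v' v0
  else (v == v0)%:R * F [::].

Lemma eq_path_expand (K : pzRingType) (F F' : seq ('I_N * 'I_N) -> K) w v v0 :
  F =1 F' -> path_expand F w v v0 = path_expand F' w v v0.
Proof.
elim: w F F' v => [|x w IH] F F' v FF' /=; first by rewrite FF'.
by apply: eq_bigr => v' _; apply: IH => s; exact: FF'.
Qed.

Lemma path_expandD (K : pzRingType) (F F' : seq ('I_N * 'I_N) -> K) w v v0 :
  path_expand (fun s => F s + F' s) w v v0 =
  path_expand F w v v0 + path_expand F' w v v0.
Proof.
elim: w F F' v => [|x w IH] F F' v /=; first by rewrite mulrDr.
by rewrite -big_split; apply: eq_bigr => v' _; exact: IH.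
Qed.

Lemma path_expandZ (K : comPzRingType) c (F : seq ('I_N * 'I_N) -> K) w v v0 :
  path_expand (fun s => c * F s) w v v0 = c * path_expand F w v v0.
Proof.
elim: w F v => [|x w IH] F v /=; first by rewrite mulrCA.
by rewrite mulr_sumr; apply: eq_bigr => v' _; exact: IH.
Qed.

Lemma rmorph_path_expand (K K' : pzRingType) (f : {rmorphism K -> K'}) F w v v0 :
  f (path_expand F w v v0) = path_expand (fun s => f (F s)) w v v0.
Proof.
elim: w F v => [|x w IH] F v /=; first by rewrite rmorphM rmorph_nat.
by rewrite rmorph_sum; apply: eq_bigr => v' _; exact: IH.
Qed.

Lemma mulmx_path_expand (K : comNzRingType) (A : 'M[K]_N) w v v0 :
  (\big[mulmx/1%:M]_(x <- w) permute_entries A (tau x)) v v0 =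
  path_expand (fun s => \prod_(p <- s) A p.1 p.2) w v v0.
Proof.
elim: w v => [|x w IH] v /=.
  by rewrite !big_nil mxE mulr1.
rewrite big_cons mxE; apply: eq_bigr => v' _; rewrite IH mxE.
by rewrite -path_expandZ; apply: eq_path_expand => s; rewrite big_cons.
Qed.

(** Contraction is linear in the continuation and commutes with the sum over the rest of the path. A
    letter can thus be contracted as soon as it is read, before the later vertices are chosen. *)
Lemma path_sum_expand (R : realType) u w v v0 :
  path_sum R tau u w v v0 =
  path_expand (wick (@entry_cov N R) (fun s => (nilp s)%:R) u) w v v0.
Proof.
have Hc p (h : seq _ -> seq _ -> R) l w' v' :
    path_expand (fun s => contract (@entry_cov N R) p (fun r => h r s) l) w' v' v0 =
    contract (@entry_cov N R) p (fun r => path_expand (h r) w' v' v0) l.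
  elim: l h => [|q l IH] h /=.
    transitivity (path_expand (fun s => 0 * (0 : R)) w' v' v0).
      by apply: eq_path_expand => s; rewrite mul0r.
    by rewrite path_expandZ mul0r.
  by rewrite path_expandD path_expandZ IH.
elim: w u v => [|x w IH] u v /=; first by rewrite -natrM mulnb andbC.
apply: eq_bigr => v' _; rewrite path_expandD Hc IH; congr (_ + _).
by apply: eq_contract => r; exact: IH.
Qed.

Context {R : realType} d {T : measurableType d} (P : probability T R).

Lemma cexpectation_sum (I : Type) (r : seq I) (X : I -> T -> R[i]) :
  (forall x, cintegrable P (X x)) ->
  cintegrable P (fun t => \sum_(x <- r) X x t) /\
  cexpectation P (fun t => \sum_(x <- r) X x t) =
  \sum_(x <- r) cexpectation P (X x).
Proof.
move=> Xi; elim: r => [|x r [IHi IHe]].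
  rewrite big_nil; split.
    by split; under eq_fun do rewrite big_nil; exact: integrable0.
  rewrite cexpectationE; under eq_Rintegral do rewrite big_nil.
  by under [X in (_ +i* X)%C]eq_Rintegral do rewrite big_nil; rewrite /= Rintegral_cst// mul0r.
have -> : (fun t => \sum_(y <- x :: r) X y t) = (fun t => X x t + \sum_(y <- r) X y t).
  by apply/funext => t; rewrite big_cons.
split; first exact: cintegrableD.
by rewrite cexpectationD// IHe big_cons.
Qed.

Lemma cexpectation_path_expand (F : T -> seq ('I_N * 'I_N) -> R[i]) w v v0 :
  (forall s, cintegrable P (F ^~ s)) ->
  cintegrable P (fun t => path_expand (F t) w v v0) /\
  cexpectation P (fun t => path_expand (F t) w v v0) =
  path_expand (fun s => cexpectation P (F ^~ s)) w v v0.
Proof.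
elim: w F v => [|x w IH] F v Fi /=.
  by split; [exact: cintegrableZ|rewrite cexpectationZ].
have IH' v' := IH (fun t s => F t (tau x (v, v') :: s)) v' (fun s => Fi _).
have [Si Se] := cexpectation_sum (index_enum 'I_N) (fun v' => (IH' v').1).
split=> //; rewrite Se; apply: eq_bigr => v' _; exact: (IH' v').2.
Qed.

Lemma trace_moment (G : T -> 'M[R[i]]_N) w : (0 < N)%N -> gaussian_matrix P G ->
  cexpectation P (fun t =>
    \tr (\big[mulmx/1%:M]_(x <- w) permute_entries (G t) (tau x)) / N%:R) =
  real_complex R (stack_path_sum R tau [::] w / N%:R).
Proof.
move=> N_gt0 hG.
have W l := gaussian_matrix_wick N_gt0 hG l.
have E v := cexpectation_path_expand w v v (fun l => (W l).1).
have [Si Se] := cexpectation_sum (index_enum 'I_N) (fun v => (E v).1).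
have -> : (fun t => \tr (\big[mulmx/1%:M]_(x <- w) permute_entries (G t) (tau x)) / N%:R) =
   (fun t => N%:R^-1 * \sum_v path_expand (fun s => \prod_(p <- s) G t p.1 p.2) w v v).
  apply/funext => t; rewrite mulrC; congr (_ * _); apply: eq_bigr => v _.
  exact: mulmx_path_expand.
rewrite cexpectationZ// Se rmorphM fmorphV rmorph_nat mulrC; congr (_ * _).
rewrite /stack_path_sum /= rmorph_sum; apply: eq_bigr => v _.
rewrite (E v).2 path_sum_expand rmorph_path_expand.
apply: eq_path_expand => s; rewrite (W s).2 rmorph_wick.
apply: eq_wick_cov => [p q|r]; last by rewrite rmorph_nat.
by rewrite /entry_cov rmorphM fmorphV !rmorph_nat.
Qed.

End PathExpansion.

(** * The free algebra on the letters *)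

Fact malg_scalerAr (K : monomType) (R : comNzRingType) (c : R) (g h : {malg R[K]}) :
  c *: (g * h) = g * (c *: h).
Proof.
apply/malgP => k; rewrite mcoeffZ mcoeffMl.
rewrite (mcoeffMlw _ (fsubset_refl _) (msuppZ_le c h)) mulr_sumr.
apply: eq_bigr => k1 _; rewrite mulr_sumr; apply: eq_bigr => k2 _.
by rewrite mcoeffZ mulrnAr mulrCA.
Qed.

(* The library already gives [{malg R[K]}] a conditional instance for
   commutative monomials, hence the alias. *)
Definition free_malg (K : monomType) (R : comNzRingType) : Type := {malg R[K]}.

HB.instance Definition _ (K : monomType) (R : comNzRingType) :=
  GRing.Lalgebra.on (free_malg K R).

HB.instance Definition _ (K : monomType) (R : comNzRingType) :=
  GRing.LSemiAlgebra_isSemiAlgebra.Build R (free_malg K R) (@malg_scalerAr K R).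

(* Unification is impractically slow on the concrete [{malg R[{fmonom L}]}], so
   only this interface to it is used. *)
Record freeAlgebra (R : comNzRingType) (L : choiceType) := FreeAlgebra {
  free_alg :> algType R;
  monomial : R -> seq L -> free_alg;
  free_lift : forall S : nzRingType, (R -> S) -> (seq L -> S) -> free_alg -> S;
  monomialM : forall c d u v,
    monomial c u * monomial d v = monomial (c * d) (u ++ v);
  monomialZ : forall c d u, c *: monomial d u = monomial (c * d) u;
  monomial1 : monomial 1 [::] = 1;
  monomial_sum : forall g, exists s : seq (R * seq L),
    g = \sum_(t <- s) monomial t.1 t.2;
  free_liftD : forall (S : nzRingType) (f : {additive R -> S}) h,
    {morph @free_lift S f h : x y / x + y};
  free_liftE : forall (S : nzRingType) (f : {additive R -> S}) h c u,
    @free_lift S f h (monomial c u) = f c * h u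
}.

Section MalgFreeAlgebra.
Variables (R : comNzRingType) (L : choiceType).

Let mono (c : R) (u : seq L) : free_malg {fmonom L} R := mkmalgU (FMonom u) c.

Let lift (S : nzRingType) (f : R -> S) (h : seq L -> S) : free_malg {fmonom L} R -> S :=
  mmap f (fun k : {fmonom L} => h k).

Let monoM c d u v : mono c u * mono d v = mono (c * d) (u ++ v).
Proof.
apply: etrans (fgmulUU _ _ _ _) _.
by congr mkmalgU; apply: val_inj; apply: fmM.
Qed.

Let monoZ c d u : c *: mono d u = mono (c * d) u.
Proof. by apply/malgP => l; rewrite mcoeffZ !mcoeffU mulrnAr. Qed.

Let mono1 : mono 1 [::] = 1.
Proof. by congr mkmalgU; apply: val_inj; rewrite /= fm1. Qed.

Let mono_sum g : exists s : seq (R * seq L), g = \sum_(t <- s) mono t.1 t.2.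
Proof.
exists [seq (mcoeff k g, k : seq L) | k <- msupp g].
by rewrite big_map; apply: etrans (monalgE _) _; apply: eq_bigr => k _; rewrite /mono fmK.
Qed.

Let liftD (S : nzRingType) (f : {additive R -> S}) h :
  {morph @lift S f h : x y / x + y}.
Proof. exact: mmapD. Qed.

Let liftE (S : nzRingType) (f : {additive R -> S}) h c u :
  lift f h (mono c u) = f c * h u.
Proof. exact: mmapU. Qed.

Definition malg_freeAlgebra : freeAlgebra R L :=
  @FreeAlgebra R L (free_malg {fmonom L} R) mono lift monoM monoZ mono1 mono_sum
    liftD liftE.

End MalgFreeAlgebra.

(** * The Fock space and its vacuum state *)

Section FockModel.
Variables (C : numClosedFieldType) (L : choiceType) (st : L -> L).
Hypothesis stK : involutive st.
Variable A : freeAlgebra C L.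
Implicit Types (c d : C) (g h : A) (f : seq L -> C) (k l u v w : seq L).

Lemma free_alg_ind (Q : A -> Prop) : Q 0 -> (forall c k, Q (monomial A c k)) ->
  (forall g h, Q g -> Q h -> Q (g + h)) -> forall g, Q g.
Proof.
move=> Q0 Q1 QD g; have [s ->] := monomial_sum g.
by apply: big_ind => // t _; exact: Q1.
Qed.

Let lift0 (S : nzRingType) (phi : {additive C -> S}) (m : seq L -> S) :
  free_lift phi m (0 : A) = 0.
Proof. by apply: (addrI (free_lift phi m (0 : A))); rewrite -free_liftD !addr0. Qed.

(* The letter [x] acts as creation by [x] plus annihilation of [st x]. *)
Fixpoint act w f u : C :=
  if w is x :: w' then
    (if u is y :: u' then (x == y)%:R * act w' f u' else 0) + act w' f (st x :: u)
  else f u.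

Definition vacuum u : C := (nilp u)%:R.

Lemma act_vacuum w u : act w vacuum u = (stack_count st w u)%:R.
Proof.
elim: w u => //= x w IH u; rewrite IH natrD addrC; congr (_ + _).
by case: u => [|y u]; rewrite ?natrM ?IH.
Qed.

Lemma act_cat w1 w2 f u : act (w1 ++ w2) f u = act w1 (act w2 f) u.
Proof. by elim: w1 u => //= x w1 IH u; rewrite IH; case: u => [|y u]; rewrite ?IH. Qed.

Lemma eq_act w f f' : f =1 f' -> act w f =1 act w f'.
Proof.
by move=> ff'; elim: w => //= x w IH u; rewrite IH; case: u => [|y u]; rewrite ?IH.
Qed.

Lemma actD w f f' u : act w (fun v => f v + f' v) u = act w f u + act w f' u.
Proof.
elim: w u => //= x w IH u; rewrite !IH.
by case: u => [|y u]; rewrite ?IH; ring.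
Qed.

Lemma actZ w c f u : act w (fun v => c * f v) u = c * act w f u.
Proof.
elim: w u => //= x w IH u; rewrite !IH.
by case: u => [|y u]; rewrite ?IH; ring.
Qed.

Lemma act0 w u : act w (fun=> 0) u = 0.
Proof. by elim: w u => //= x w IH [|y u]; rewrite !IH ?mulr0 addr0. Qed.

(** Linear extension of the action from words to the algebra. The vectors [f] are arbitrary
    functions on words, and the value at [[::]] is the inner product with the vacuum. *)
Definition alg_act g f u : C := free_lift idfun (fun k => act k f u) g.

Lemma alg_actD g h f u : alg_act (g + h) f u = alg_act g f u + alg_act h f u.
Proof. exact: free_liftD. Qed.

Lemma alg_actU c k f u : alg_act (monomial A c k) f u = c * act k f u.
Proof. exact: free_liftE. Qed.

Lemma alg_act0 f u : alg_act 0 f u = 0.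
Proof. exact: lift0. Qed.

Lemma alg_actZ c g f u : alg_act (c *: g) f u = c * alg_act g f u.
Proof.
elim/free_alg_ind: g => [|d k|g1 g2 IH1 IH2].
- by rewrite scaler0 alg_act0 mulr0.
- by rewrite monomialZ !alg_actU mulrA.
- by rewrite scalerDr !alg_actD IH1 IH2 mulrDr.
Qed.

Lemma eq_alg_act g f f' : f =1 f' -> alg_act g f =1 alg_act g f'.
Proof.
move=> ff' u; elim/free_alg_ind: g => [|c k|g h IH1 IH2].
- by rewrite !alg_act0.
- by rewrite !alg_actU (eq_act _ ff').
- by rewrite !alg_actD IH1 IH2.
Qed.

Lemma alg_actM g h f u : alg_act (g * h) f u = alg_act g (alg_act h f) u.
Proof.
elim/free_alg_ind: g => [|c k|g1 g2 IH1 IH2]; first by rewrite mul0r !alg_act0.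
  rewrite alg_actU; elim/free_alg_ind: h => [|d l|h1 h2 IH1 IH2].
  - rewrite mulr0 alg_act0 (@eq_act _ _ (fun=> 0)) ?act0 ?mulr0//.
    by move=> v; exact: alg_act0.
  - rewrite monomialM alg_actU act_cat.
    rewrite (@eq_act k (alg_act _ _) (fun v => d * act l f v)).
      by rewrite actZ mulrA.
    by move=> v; exact: alg_actU.
  - rewrite mulrDr alg_actD IH1 IH2 -mulrDr -actD.
    by congr (_ * _); apply: eq_act => v; rewrite alg_actD.
by rewrite mulrDl !alg_actD IH1 IH2.
Qed.

Lemma alg_act1 f u : alg_act 1 f u = f u.
Proof. by rewrite -monomial1 alg_actU mul1r. Qed.

(** The star is antilinear; [free_lift] accepts it because it asks only for an additive map of the
    coefficients. *)
Let conjC_alg c : A := monomial A c^* [::].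

Let conjC_alg_additive : zmod_morphism conjC_alg.
Proof.
have E c : conjC_alg c = c^* *: 1 by rewrite /conjC_alg -monomial1 monomialZ mulr1.
by move=> c d; rewrite !E rmorphB scalerBl.
Qed.

HB.instance Definition _ := GRing.isZmodMorphism.Build C A conjC_alg conjC_alg_additive.

Definition word_star k := rev (map st k).

Definition alg_star g : A := free_lift conjC_alg (fun k => monomial A 1 (word_star k)) g.

Lemma alg_starU c k : alg_star (monomial A c k) = monomial A c^* (word_star k).
Proof. by rewrite /alg_star free_liftE /conjC_alg /= monomialM mulr1. Qed.

Lemma alg_starD g h : alg_star (g + h) = alg_star g + alg_star h.
Proof. exact: free_liftD. Qed.

Lemma alg_star0 : alg_star 0 = 0.
Proof. exact: lift0. Qed.

Lemma word_starK : involutive word_star.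
Proof.
move=> k; rewrite /word_star map_rev revK -map_comp.
by rewrite (eq_map (g := id)) ?map_id// => x; exact: stK.
Qed.

Lemma word_star_cat k l : word_star (k ++ l) = word_star l ++ word_star k.
Proof. by rewrite /word_star map_cat rev_cat. Qed.

Lemma alg_starK : involutive alg_star.
Proof.
elim/free_alg_ind => [|c k|g h IH1 IH2]; first by rewrite !alg_star0.
  by rewrite !alg_starU word_starK conjCK.
by rewrite !alg_starD IH1 IH2.
Qed.

Lemma alg_starZ c g : alg_star (c *: g) = c^* *: alg_star g.
Proof.
elim/free_alg_ind: g => [|d k|g h IH1 IH2]; first by rewrite scaler0 alg_star0 scaler0.
  by rewrite monomialZ !alg_starU monomialZ rmorphM.
by rewrite scalerDr !alg_starD IH1 IH2 scalerDr.
Qed.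

Lemma alg_starM g h : alg_star (g * h) = alg_star h * alg_star g.
Proof.
elim/free_alg_ind: g => [|c k|g1 g2 IH1 IH2]; first by rewrite mul0r alg_star0 mulr0.
  elim/free_alg_ind: h => [|d l|h1 h2 IH1 IH2]; first by rewrite mulr0 alg_star0 mul0r.
    by rewrite monomialM !alg_starU monomialM rmorphM mulrC word_star_cat.
  by rewrite mulrDr !alg_starD IH1 IH2 mulrDl.
by rewrite mulrDl !alg_starD IH1 IH2 mulrDr.
Qed.

Definition vacuum_state g : C := alg_act g vacuum [::].

(* The words, with multiplicity, of the vector obtained from the vacuum. *)
Fixpoint reach w : seq (seq L) :=
  if w is x :: w' then
    [seq x :: u | u <- reach w'] ++
    [seq behead u | u <- [seq u <- reach w' | ohead u == Some (st x)]]
  else [:: [::]].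

(** Creation and annihilation are adjoint: the left side pairs the vacuum with the adjoint of [w]
    applied to [f], the right side pairs [w] applied to the vacuum with [f]. *)
Lemma act_rev_star w f : act (rev (map st w)) f [::] = \sum_(u <- reach w) f u.
Proof.
elim: w f => [|x w IH] f /=; first by rewrite big_seq1.
rewrite rev_cons -cats1 act_cat IH /= big_cat !big_map big_filter /=.
rewrite [X in _ = _ + X]big_mkcond -big_split; apply: eq_bigr => u _ /=.
rewrite stK addrC; congr (_ + _); case: u => [|y u] //=.
by rewrite (inj_eq Some_inj) eq_sym; case: eqP => _; rewrite ?mul1r ?mul0r.
Qed.

Lemma act_vacuum_reach w u : act w vacuum u = \sum_(v <- reach w) (v == u)%:R.
Proof.
elim: w u => [|x w IH] u /=; first by rewrite big_seq1 eq_sym /vacuum; case: u.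
rewrite IH big_cat !big_map big_filter /=; congr (_ + _).
  case: u => [|y u].
    by rewrite big1.
  rewrite IH mulr_sumr; apply: eq_bigr => v _; rewrite eqseq_cons -natrM mulnb.
  by [].
rewrite [RHS]big_mkcond; apply: eq_bigr => v _ /=; case: v => [|y v] //=.
by rewrite eqseq_cons (inj_eq Some_inj); case: eqP.
Qed.

(** If [g] turns the vacuum into [F], adjointness makes the state of [alg_star g * g] the sum of
    [|F z|^2] over the words [z]. *)
Lemma vacuum_state_ge0 g : 0 <= vacuum_state (alg_star g * g).
Proof.
rewrite /vacuum_state alg_actM.
have [s gs] := monomial_sum g; pose F := alg_act g vacuum.
have actE (f : seq L -> C) : alg_act (alg_star g) f [::] =
    \sum_(t <- s) t.1^* * \sum_(u <- reach t.2) f u.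
  rewrite gs; elim: s {gs} => [|t s IH]; first by rewrite !big_nil alg_star0 alg_act0.
  by rewrite !big_cons alg_starD alg_actD IH alg_starU alg_actU act_rev_star.
have FE z : F z = \sum_(t <- s) t.1 * \sum_(v <- reach t.2) (v == z)%:R.
  rewrite /F gs; elim: s {gs F actE} => [|t s IH]; first by rewrite !big_nil alg_act0.
  by rewrite !big_cons alg_actD IH alg_actU act_vacuum_reach.
rewrite actE -/F.
(* A finite set of words that contains the support of [F], so that the inner product is a finite
   sum. *)
pose S := undup (flatten [seq reach t.2 | t <- s]).
have SE t : t \in s ->
    \sum_(u <- reach t.2) F u = \sum_(z <- S) (\sum_(u <- reach t.2) (u == z)%:R) * F z.
  move=> ts; under [RHS]eq_bigr do rewrite mulr_suml.
  rewrite exchange_big /= big_seq [RHS]big_seq; apply: eq_bigr => u uk.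
  have uS : u \in S.
    rewrite mem_undup; apply/flattenP; exists (reach t.2) => //.
    by apply/mapP; exists t.
  rewrite (bigD1_seq u)//= ?undup_uniq// eqxx mul1r big1 ?addr0// => z zu.
  by rewrite eq_sym (negPf zu) mul0r.
have -> : \sum_(t <- s) t.1^* * \sum_(u <- reach t.2) F u =
    \sum_(z <- S) (F z)^* * F z.
  transitivity (\sum_(t <- s) \sum_(z <- S)
     (t.1^* * \sum_(u <- reach t.2) (u == z)%:R) * F z).
    rewrite big_seq [RHS]big_seq; apply: eq_bigr => t ts.
    by rewrite SE// mulr_sumr; apply: eq_bigr => z _; rewrite mulrA.
  rewrite exchange_big; apply: eq_bigr => z _; rewrite -mulr_suml {2}FE.
  congr (_ * _); rewrite rmorph_sum; apply: eq_bigr => t _; rewrite rmorphM.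
  congr (_ * _); rewrite rmorph_sum; apply: eq_bigr => u _.
  by rewrite rmorph_nat.
by apply: sumr_ge0 => z _; rewrite mulrC mul_conjC_ge0.
Qed.

Fact vacuum_state_scalar : scalable_for *%R (vacuum_state : A -> C).
Proof. by move=> c g; exact: alg_actZ. Qed.

Fact vacuum_state_additive : zmod_morphism (vacuum_state : A -> C).
Proof.
move=> g h; rewrite /vacuum_state -scaleN1r alg_actD alg_actZ mulN1r.
by [].
Qed.

HB.instance Definition _ := GRing.isZmodMorphism.Build (A) C
  vacuum_state vacuum_state_additive.
HB.instance Definition _ := GRing.isScalable.Build C (A) C *%R
  vacuum_state vacuum_state_scalar.

Fact vacuum_state1 : vacuum_state 1 = 1.
Proof. by rewrite /vacuum_state alg_act1. Qed.

Definition fock_space : ncProbSpace C :=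
  @NcProbSpace C (A) alg_star vacuum_state alg_starK alg_starD alg_starZ
    alg_starM vacuum_state1 vacuum_state_ge0.

Definition letter (x : L) : fock_space := monomial A 1 [:: x].

Lemma star_letter x : nc_star (letter x) = letter (st x).
Proof. by rewrite /letter /= alg_starU conjC1. Qed.

Lemma prod_letters w : \prod_(x <- w) letter x = monomial A 1 w.
Proof.
elim: w => [|x w IH]; first by rewrite big_nil -monomial1.
by rewrite big_cons IH /letter; apply: etrans (monomialM _ _ _ _ _) _; rewrite mulr1.
Qed.

Lemma letters_moment w :
  nc_phi fock_space (\prod_(x <- w) letter x) = (stack_count st w [::])%:R.
Proof.
by rewrite prod_letters; apply: etrans (alg_actU _ _ _ _) _; rewrite mul1r act_vacuum.
Qed.

(** * Freeness of letters of different colours *)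

Section Freeness.
Variables (K : eqType) (color : L -> K).
Hypothesis color_st : forall x, color (st x) = color x.

Fixpoint color_prefix (a : K) u : seq L :=
  if u is x :: u' then if color x == a then x :: color_prefix a u' else [::]
  else [::].

Fixpoint color_suffix (a : K) u : seq L :=
  if u is x :: u' then if color x == a then color_suffix a u' else u else [::].

(* [g] only acts on the tensor factor of colour [a] of the words. *)
Let local_action a (g : fock_space) := forall f1 f2 u,
  alg_act g (fun v => f1 (color_prefix a v) * f2 (color_suffix a v)) u =
  alg_act g f1 (color_prefix a u) * f2 (color_suffix a u).

Let alg_act_letter x f u : alg_act (letter x) f u = act [:: x] f u.
Proof. by apply: etrans (alg_actU _ _ _ _) _; rewrite mul1r. Qed.

(** A letter creates or annihilates only at the head of a word, and only letters of its own colour;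
    the suffix is never touched. *)
Let local_letter x : local_action (color x) (letter x).
Proof.
move=> f1 f2 u; rewrite 2!alg_act_letter /= color_st eqxx.
case: u => [|y u] /=; first by rewrite !add0r.
have [->|yx] := eqVneq y x.
  by rewrite !eqxx /= mulrDl mulrA.
rewrite mulr0n mul0r add0r; case: eqP => _ /=; last by rewrite add0r.
by rewrite [x == y]eq_sym (negPf yx) mulr0n mul0r add0r.
Qed.

Let localD a (g h : fock_space) : local_action a g -> local_action a h ->
  local_action a (g + h).
Proof. by move=> Hg Hh f1 f2 u; rewrite !alg_actD Hg Hh mulrDl. Qed.

Let localZ a c (g : fock_space) : local_action a g -> local_action a (c *: g).
Proof. by move=> Hg f1 f2 u; rewrite !alg_actZ Hg mulrA. Qed.

Let local1 a : local_action a 1.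
Proof. by move=> f1 f2 u; rewrite !alg_act1. Qed.

Let localM a (g h : fock_space) : local_action a g -> local_action a h ->
  local_action a (g * h).
Proof.
move=> Hg Hh f1 f2 u; rewrite !alg_actM -Hg; apply: eq_alg_act => v.
exact: Hh.
Qed.

(** Locality of [nc_star g] is carried along, since the closure under the star requires it; in that
    case the two halves change places. *)
Let star_generated_local x (g : fock_space) : star_generated (letter x) g ->
  local_action (color x) g /\ local_action (color x) (nc_star g).
Proof.
elim=> {g} [||g h _ [g1 g2] _ [h1 h2]|c g _ [g1 g2]|g h _ [g1 g2] _ [h1 h2]|g _ [g1 g2]].
- by rewrite star_letter; split; [exact: local_letter|rewrite -(color_st x); exact: local_letter].
- have -> : nc_star (1 : fock_space) = 1.
    have := nc_starM (1 : fock_space) (nc_star 1).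
    by rewrite mul1r !nc_starK mul1r.
  by split; exact: local1.
- by split; [exact: localD|rewrite nc_starD; exact: localD].
- by split; [exact: localZ|rewrite nc_starZ; exact: localZ].
- by split; [exact: localM|rewrite nc_starM; exact: localM].
- by rewrite nc_starK.
Qed.

(** An alternating product of centred elements sends the vacuum to a vector supported on words that
    begin with the colour of the leftmost factor. Its value at the empty word, which is the state,
    is therefore 0. *)
Lemma letters_star_free (J : eqType) (a : J -> L) : injective (color \o a) ->
  star_free (fun i => letter (a i)).
Proof.
move=> ainj s s0 sorted_s alg_s.
pose starts i u := if u is x :: _ then color x == color (a i) else false.
suff H : forall u, ~~ (if s is p :: _ then starts p.1 u else nilp u) ->
    alg_act (\prod_(p <- s) p.2 : fock_space) vacuum u = 0.
  by have := H [::]; case: s s0 {sorted_s alg_s H} => // p s _ /(_ isT).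
elim: s {s0} sorted_s alg_s => [|[i g] s IH] sorted_s alg_s u.
  by rewrite big_nil alg_act1 /vacuum; case: nilp.
rewrite big_cons [alg_act _ _ _]alg_actM /= => nu.
have [gi phi_g] := alg_s (i, g) (mem_head _ _).
have {}IH := IH (path_sorted sorted_s) (fun p ps => alg_s p (@mem_behead _ (_ :: _) p ps)).
set f := alg_act _ vacuum in IH *.
have fns x v : color x = color (a i) -> f (x :: v) = 0.
  move=> xi; apply: IH; case: s sorted_s {alg_s f} => // [[j h] s] /= /andP[ij _].
  by rewrite xi (inj_eq ainj).
(* By induction [f] vanishes on words that begin with the colour of [a i], so it is the vacuum in
   that colour times its value on the suffix, and [g] acts on the first factor alone. At a word with
   empty prefix that factor becomes the state of [g], which is 0. *)
have fE : f =1 (fun v => vacuum (color_prefix (color (a i)) v) *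
                         f (color_suffix (color (a i)) v)).
  move=> [|x v] /=; first by rewrite mul1r.
  by case: eqP => [/fns ->|_]; rewrite ?mul0r ?mul1r.
rewrite (eq_alg_act _ fE) (star_generated_local gi).1.
have -> : color_prefix (color (a i)) u = [::].
  by case: u nu => //= x u /negPf ->.
by have -> : alg_act g vacuum [::] = 0; [exact: phi_g|rewrite mul0r].
Qed.

End Freeness.

End FockModel.

(** * The stack count as a sum over noncrossing partitions *)

Section NoncrossingPairings.
Variables (L : eqType) (st : L -> L) (n : nat) (ell : 'I_n -> L).

(** This will be the free cumulant of the letters of [w]. *)
Definition pair_weight (w : seq L) : nat :=
  if w is [:: x; y] then y == st x else 0.

Let f (V : {set 'I_n}) : nat := pair_weight [seq ell i | i <- enum V].

Let f_card V : f V != 0%N -> #|V| = 2.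
Proof. by rewrite /f cardE; case: (enum V) => [|x [|y []]]. Qed.

Let f_pair (t r : 'I_n) : (t < r)%N -> f [set t; r]%SET = (ell r == st (ell t)).
Proof.
move=> tr; rewrite /f (_ : enum _ = [:: t; r])//.
have tNr : t != r by rewrite neq_ltn tr.
have leT : transitive (fun i j : 'I_n => (i <= j)%N) by move=> a b c; exact: leq_trans.
have leA : antisymmetric (fun i j : 'I_n => (i <= j)%N).
  by move=> a b /anti_leq /val_inj.
apply: (sorted_eq leT leA).
- rewrite /enum_mem; apply: sorted_filter => //.
  rewrite -[Finite.enum _]enumT.
  have := iota_sorted 0 n; rewrite -val_enum_ord sorted_map.
  by [].
- by rewrite /= ltnW.
- apply: uniq_perm; rewrite ?enum_uniq//= ?inE ?tNr// => x.
  by rewrite mem_enum !inE.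
Qed.

(* [us] is the stack of open positions, most recent first, and [ws] lists the
   positions still to be read. *)
Let admissible (us ws : seq 'I_n) (p : {set {set 'I_n}}) :=
  [&& finset.partition p [set i in us ++ ws], noncrossing p &
      [forall V in p, ~~ (V \subset us)]].

Let weight (p : {set {set 'I_n}}) := (\prod_(V in p) f V)%N.

Let weight_pair p V : weight p != 0%N -> V \in p -> #|V| = 2.
Proof.
move=> wp Vp; apply: f_card; apply: contra wp => /eqP fV.
by rewrite /weight (bigD1 V)//= fV mul0n.
Qed.

Let lt_seq (us ws : seq 'I_n) :=
  [&& sorted (fun i j : 'I_n => (j < i)%N) us, sorted (fun i j : 'I_n => (i < j)%N) ws
   & allrel (fun i j : 'I_n => (i < j)%N) us ws].

Let gtT : transitive (fun i j : 'I_n => (j < i)%N).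
Proof. by move=> a b c ba cb; exact: ltn_trans cb ba. Qed.

Let ltT : transitive (fun i j : 'I_n => (i < j)%N).
Proof. by move=> a b c; exact: ltn_trans. Qed.

Let lt_seq_open us r ws : lt_seq us (r :: ws) -> lt_seq (r :: us) ws.
Proof.
move=> /and3P[su sw]; rewrite allrel_consr => /andP[/allP ur uw].
apply/and3P; split; last 2 first.
- exact: path_sorted sw.
- by rewrite allrel_consl uw andbT; exact: order_path_min sw.
by case: us su ur {uw} => //= t us -> ur; rewrite andbT ur ?mem_head.
Qed.

Let lt_seq_close t us r ws : lt_seq (t :: us) (r :: ws) -> lt_seq us ws.
Proof.
move=> /and3P[su sw]; rewrite allrel_consl allrel_consr => /andP[_ /andP[_ uw]].
by apply/and3P; split; rewrite ?(path_sorted su) ?(path_sorted sw).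
Qed.

Let noncrossing_sub (p q : {set {set 'I_n}}) : q \subset p -> noncrossing p -> noncrossing q.
Proof.
move=> /fintype.subsetP qp /forall_inP H; apply/forall_inP => V Vq; apply/forall_inP => W Wq.
by have /forall_inP := H V (qp _ Vq); apply; exact: qp.
Qed.

Let admissible_open us r ws p : lt_seq us (r :: ws) ->
  admissible us (r :: ws) p && [forall V in p, ~~ (V \subset r :: us)] =
  admissible (r :: us) ws p.
Proof.
move=> _; rewrite /admissible.
have -> : [set i in us ++ r :: ws]%SET = [set i in (r :: us) ++ ws]%SET.
  by apply/setP => i; rewrite !inE !mem_cat !inE orbCA orbA.
case: (finset.partition _ _) => //=; case: (noncrossing p) => //=.
apply/andP/forall_inP => [[_ /forall_inP //]|H].
split; apply/forall_inP => V Vp; last exact: H.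
apply: contra (H V Vp) => /fintype.subsetP Vu; apply/fintype.subsetP => i /Vu iu.
by rewrite inE iu orbT.
Qed.

Let lt_seq_notin t us r ws : lt_seq (t :: us) (r :: ws) ->
  [/\ (t < r)%N, forall i, i \in us -> (i < t)%N & forall i, i \in ws -> (r < i)%N].
Proof.
move=> /and3P[su sw]; rewrite allrel_consl => /andP[/andP[tr _] _].
split=> // i ii.
  exact: (allP (order_path_min gtT su)).
exact: (allP (order_path_min ltT sw)).
Qed.

Let dom_close t us r ws : lt_seq (t :: us) (r :: ws) ->
  ([set i in (t :: us) ++ r :: ws] :\: [set t; r])%SET = [set i in us ++ ws]%SET.
Proof.
move=> /lt_seq_notin[tr ut wr]; apply/setP => i; rewrite !inE !mem_cat !inE.
have [->|it] := eqVneq i t.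
  rewrite /=; apply/esym/negbTE; rewrite negb_or; apply/andP; split.
    by apply/negP => /ut; rewrite ltnn.
  by apply/negP => /wr rt; have := ltn_trans tr rt; rewrite ltnn.
have [->|//] := eqVneq i r.
rewrite /=; apply/esym/negbTE; rewrite negb_or; apply/andP; split.
  by apply/negP => /ut rt; have := ltn_trans tr rt; rewrite ltnn.
by apply/negP => /wr; rewrite ltnn.
Qed.

(** Among the positions in play, [t] and [r] are neighbours: the other open ones precede [t], the
    unread ones follow [r]. The block [[set t; r]] thus crosses no other block and can be removed or
    inserted freely. *)
Let admissible_close t us r ws (p : {set {set 'I_n}}) : lt_seq (t :: us) (r :: ws) ->
  [set t; r]%SET \in p ->
  admissible (t :: us) (r :: ws) p = admissible us ws (p :\ [set t; r])%SET.
Proof.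
move=> lt_ur; set B := [set t; r]%SET => Bp.
have [tr ut wr] := lt_seq_notin lt_ur.
have D'E := dom_close lt_ur; set D' := [set i in us ++ ws]%SET in D'E.
rewrite /admissible -/D'.
have out i : i \in D' -> (t < i)%N -> (i < r)%N -> False.
  rewrite !inE mem_cat => /orP[/ut it ti _|/wr ri _ ir].
    by have := ltn_trans it ti; rewrite ltnn.
  by have := ltn_trans ri ir; rewrite ltnn.
apply/and3P/and3P => -[pD nc /forall_inP cond].
  split.
  - by rewrite -D'E; exact: partitionD1.
  - by apply: noncrossing_sub nc; exact: finset.subD1set.
  - apply/forall_inP => V; rewrite !inE => /andP[_ Vp].
    apply: contra (cond V Vp) => /fintype.subsetP Vu; apply/fintype.subsetP => i /Vu iu.
    by rewrite inE iu orbT.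
have VD' V : V \in p -> V != B -> V \subset D'.
  move=> Vp VB; have /and3P[/eqP <- _ _] := pD.
  by apply: bigcup_max; last exact: fintype.subxx; rewrite !inE VB.
split.
- rewrite -(finset.setD1K Bp).
  have -> : [set i in (t :: us) ++ r :: ws]%SET = (B :|: D')%SET.
    rewrite -D'E; apply/setP => i; rewrite !inE !mem_cat !inE.
    by case: (i == t); case: (i == r); rewrite ?orbT.
  apply: partitionU1 => //; first by apply/set0Pn; exists t; rewrite !inE eqxx.
  by rewrite -D'E disjoint_sym finset.disjoints_subset; apply/fintype.subsetP => i; rewrite !inE => /andP[].
- apply/forall_inP => V Vp; apply/forall_inP => W Wp; apply/implyP => VW.
  have [VB|VB] := eqVneq V B; [|have [WB|WB] := eqVneq W B].
  + have /fintype.subsetP WD : W \subset D' by apply: VD' => //; rewrite -VB eq_sym.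
    apply/negP => /exists_inP[a aV /exists_inP[b /WD bD /exists_inP[c cV /exists_inP[e _ /and3P[ab bc _]]]]].
    move: aV cV; rewrite VB !inE => /orP[] /eqP ea /orP[] /eqP ec; subst a c.
    * by have := ltn_trans ab bc; rewrite ltnn.
    * exact: out bD ab bc.
    * by have := ltn_trans tr (ltn_trans ab bc); rewrite ltnn.
    * by have := ltn_trans ab bc; rewrite ltnn.
  + have /fintype.subsetP VD : V \subset D' by apply: VD'.
    apply/negP => /exists_inP[a _ /exists_inP[b bW /exists_inP[c /VD cD /exists_inP[e eW /and3P[_ bc ce]]]]].
    move: bW eW; rewrite WB !inE => /orP[] /eqP eb /orP[] /eqP ee; subst b e.
    * by have := ltn_trans bc ce; rewrite ltnn.
    * exact: out cD bc ce.
    * by have := ltn_trans tr (ltn_trans bc ce); rewrite ltnn.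
    * by have := ltn_trans bc ce; rewrite ltnn.
  + have /forall_inP /(_ V) := nc; rewrite !inE VB Vp => /(_ isT) /forall_inP /(_ W).
    by rewrite !inE WB Wp VW => /(_ isT).
- apply/forall_inP => V Vp; have [->|VB] := eqVneq V B.
    apply/negP => /fintype.subsetP /(_ r); rewrite !inE eqxx orbT => /(_ isT).
    move=> /orP[/eqP rt|/ut rt]; first by rewrite rt ltnn in tr.
    by have := ltn_trans tr rt; rewrite ltnn.
  apply/negP => /fintype.subsetP Vu.
  have := cond V; rewrite !inE VB Vp => /(_ isT) /negP; apply.
  apply/fintype.subsetP => i iV; have := Vu i iV; rewrite inE => /orP[/eqP it|//].
  have /fintype.subsetP /(_ i iV) := VD' V Vp VB.
  rewrite -D'E !inE it eqxx.
  by [].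
Qed.

(** If all blocks are pairs and [r] is matched with some [u] deeper in the stack, then [t] has its
    partner [s] after [r], and [u < t < r < s] is a crossing. *)
Let weight_close t us r ws (p : {set {set 'I_n}}) : lt_seq (t :: us) (r :: ws) ->
  admissible (t :: us) (r :: ws) p ->
  ~~ [forall V in p, ~~ (V \subset r :: t :: us)] ->
  [set t; r]%SET \notin p -> weight p = 0%N.
Proof.
move=> lt_ur /and3P[pD nc /forall_inP cond].
have [tr ut wr] := lt_seq_notin lt_ur.
rewrite negb_forall_in => /exists_inP[V Vp]; rewrite negbK => /fintype.subsetP Vru Bp.
apply/eqP; apply: contraNT Bp => wp.
have /and3P[/eqP cover_p triv_p _] := pD.
have tNr : t != r by rewrite neq_ltn tr.
have rV : r \in V.
  apply: contraNT (cond V Vp) => rV; apply/fintype.subsetP => i iV.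
  by have := Vru i iV; rewrite inE => /orP[/eqP ir|//]; rewrite -ir iV in rV.
have /eqP := weight_pair wp Vp; rewrite (cardsD1 r) rV add1n eqSS.
move=> /cards1P[u Vu].
have VE : V = [set r; u]%SET by rewrite -(finset.setD1K rV) Vu.
have : u \in (V :\ r)%SET by rewrite Vu inE.
rewrite !inE => /andP[ur uV].
have := Vru u uV; rewrite inE (negPf ur) /= inE => /orP[/eqP ut'|uus].
  by rewrite -ut' finset.setUC -VE.
have tD : t \in finset.cover p by rewrite cover_p !inE eqxx.
have [W Wp tW] := bigcupP tD.
have VW : V != W.
  apply/eqP => eVW; rewrite -eVW VE !inE (negPf tNr) /= in tW.
  by have := ut u uus; rewrite (eqP tW) ltnn.
have dVW := finset.trivIsetP triv_p V W Vp Wp VW.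
have /eqP := weight_pair wp Wp; rewrite (cardsD1 t) tW add1n eqSS.
move=> /cards1P[s Ws].
have WE : W = [set t; s]%SET by rewrite -(finset.setD1K tW) Ws.
have sW : s \in W by rewrite WE !inE eqxx orbT.
have sus : s \notin t :: us.
  apply: contra (cond W Wp) => sus; apply/fintype.subsetP => i.
  by rewrite WE !inE => /orP[/eqP ->|/eqP ->]; rewrite ?eqxx// -in_cons.
have sr : s != r.
  by apply: contraTneq sW => ->; rewrite (disjointFr dVW rV).
have rs : (r < s)%N.
  have : s \in [set i in (t :: us) ++ r :: ws]%SET.
    by rewrite -cover_p; apply/bigcupP; exists W.
  by rewrite inE mem_cat (negPf sus) /= inE (negPf sr) /=; exact: wr.
have /forall_inP /(_ V Vp) /forall_inP /(_ W Wp) := nc.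
rewrite VW /= => /negP; case.
apply/exists_inP; exists u => //; apply/exists_inP; exists t => //.
apply/exists_inP; exists r => //; apply/exists_inP; exists s => //.
by rewrite ut// tr rs.
Qed.

(** The weight selects pairings, and the condition on blocks in [admissible] says that an open
    position waits for a partner still to be read. These sums obey the recursion of
    [stack_count]. *)
Let S us ws := (\sum_(p | admissible us ws p) weight p)%N.

Let S_nil us : S us [::] = nilp us.
Proof.
rewrite /S; case: us => [|t us] /=.
  rewrite (big_pred1 finset.set0) => [|p].
    by rewrite /weight big_set0.
  apply/and3P/eqP => [[pD _ /forall_inP cond]|->].
    apply/eqP; apply/set0Pn => -[V Vp]; have /and3P[/eqP cov _ _] := pD.
    apply/negP: (cond V Vp); rewrite negbK.
    apply/fintype.subsetP => i iV.
    have : i \in finset.cover p by apply/bigcupP; exists V.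
    by rewrite cov !inE.
  split; last by apply/forall_inP => V; rewrite inE.
  - apply/and3P; split; rewrite ?inE//.
      by rewrite /finset.cover big_set0; apply/eqP/setP => i; rewrite !inE.
    by apply/finset.trivIsetP => V W; rewrite inE.
  - by apply/forall_inP => V; rewrite inE.
rewrite big_pred0// => p; apply/negP => /and3P[/and3P[/eqP cov _ _] _ /forall_inP cond].
have : t \in finset.cover p by rewrite cov !inE eqxx.
move=> /bigcupP[V Vp _]; have /negP := cond V Vp; apply.
apply/fintype.subsetP => i iV.
have : i \in finset.cover p by apply/bigcupP; exists V.
by rewrite cov inE cats0.
Qed.

Let S_cons us r ws : lt_seq us (r :: ws) ->
  S us (r :: ws) = (S (r :: us) ws +
    (if us is t :: us' then (ell r == st (ell t)) * S us' ws else 0))%N.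
Proof.
move=> lt_ur; rewrite /S.
(* Either [r] is left open, or some block lies inside [r :: us]; for a nonzero weight [r] is then
   paired with the top of the stack. *)
rewrite (bigID (fun p : {set {set 'I_n}} => [forall V in p, ~~ (V \subset r :: us)])) /=.
congr (_ + _)%N; first by apply: eq_bigl => p; exact: admissible_open.
case: us lt_ur => [|t us] lt_ur.
  apply: big1 => p /andP[/and3P[_ _ _]].
  rewrite negb_forall_in => /exists_inP[V Vp]; rewrite negbK => Vr.
  apply/eqP; apply: contraT => wp; have := weight_pair wp Vp.
  have : (#|V| <= #|[set r]%SET|)%N.
    by apply: subset_leq_card; apply: fintype.subset_trans Vr _; apply/fintype.subsetP => i; rewrite !inE.
  by rewrite cards1 => + V2; rewrite V2.
set B := [set t; r]%SET.
have [tr ut wr] := lt_seq_notin lt_ur.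
transitivity (\sum_(p | admissible (t :: us) (r :: ws) p && (B \in p)) weight p)%N.
  rewrite (bigID (fun p : {set {set 'I_n}} => B \in p)) /= [X in (_ + X)%N]big1 ?addn0.
    apply: eq_bigl => p; have [Bp|] := boolP (B \in p); rewrite ?andbF// !andbT.
    case: (admissible _ _ p) => //=; apply/negP => /forall_inP /(_ B Bp) /negP; apply.
    by apply/fintype.subsetP => i; rewrite !inE => /orP[] ->; rewrite ?orbT.
  by move=> p /andP[/andP[adm nall] Bp]; exact: weight_close lt_ur adm nall Bp.
rewrite (reindex_onto (fun q => B |: q)%SET (fun p => p :\ B)%SET) /=; last first.
  by move=> p /andP[_ Bp]; rewrite finset.setD1K.
have adm_notin q : admissible us ws q -> B \notin q.
  move=> /and3P[/and3P[/eqP cov _ _] _ _]; apply/negP => Bq.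
  have : t \in finset.cover q by apply/bigcupP; exists B; rewrite // !inE eqxx.
  by rewrite cov -(dom_close lt_ur) !inE eqxx.
rewrite big_distrr /=; apply: eq_big => [q|q /andP[/andP[_ _] /eqP qB]].
  rewrite finset.setU11 andbT; have [/eqP qB|qB] := boolP (_ == q).
    by rewrite andbT (admissible_close lt_ur) ?finset.setU11// qB.
  rewrite andbF; apply/esym/negP => /adm_notin Bq.
  by case/negP: qB; rewrite finset.setU1K.
have Bq : B \notin q by rewrite -qB !inE eqxx.
by rewrite /weight big_setU1//= f_pair.
Qed.

Let stack_count_S us ws : lt_seq us ws ->
  S us ws = stack_count st [seq ell i | i <- ws] [seq st (ell i) | i <- us].
Proof.
elim: ws us => [|r ws IH] us lt_uw; first by rewrite S_nil /= /nilp size_map.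
rewrite S_cons// (IH (r :: us)) ?lt_seq_open//=; congr (_ + _)%N.
by case: us lt_uw => [|t us] //= lt_uw; rewrite IH ?(lt_seq_close lt_uw).
Qed.

Lemma stack_count_NC :
  stack_count st [seq ell i | i <- enum 'I_n] [::] =
  (\sum_(p in NC n) \prod_(V in p) pair_weight [seq ell i | i <- enum V])%N.
Proof.
rewrite -(@stack_count_S [::] (enum 'I_n)).
  apply: eq_bigl => p; rewrite /admissible inE.
  have -> : [set i in [::] ++ enum 'I_n]%SET = [set: 'I_n]%SET.
    by apply/setP => i; rewrite !inE mem_enum.
  case: (boolP (finset.partition _ _)) => //= pD; case: noncrossing => //=.
  apply/forall_inP => V Vp; apply/negP => V0; have /and3P[_ _ /negP] := pD; apply.
  rewrite (_ : finset.set0 = V)//; apply/setP => i; rewrite inE; apply/esym/negP.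
  by move/(fintype.subsetP V0).
apply/and3P; split=> //.
by have := iota_ltn_sorted 0 n; rewrite -val_enum_ord sorted_map.
Qed.

End NoncrossingPairings.

(** * Free cumulants of the letters *)

Section FockCumulants.
Variables (C : numClosedFieldType) (L : choiceType) (st : L -> L).
Hypothesis stK : involutive st.
Variable A : freeAlgebra C L.

(** The moment is expanded over noncrossing partitions in two ways, by cumulants and by pair
    weights. The terms with smaller blocks agree by induction, so the one-block terms agree. *)
Lemma fock_free_cumulant (w : seq L) :
  free_cumulant [seq letter stK A x | x <- w] = (pair_weight st w)%:R.
Proof.
have [m] := ubnP (size w); elim: m w => // m IH w; rewrite ltnS => wm.
have [->|[x0 w_gt0]] : w = [::] \/ exists _ : L, (0 < size w)%N.
- by case: (w) => [|x w']; [left|right; exists x].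
- by [].
set s := [seq letter stK A x | x <- w].
have s_w : size s = size w by rewrite size_map.
pose ell (i : 'I_(size s)) := nth x0 w i.
have subE V : subword V = [seq letter stK A x | x <- [seq ell i | i <- enum V]].
  rewrite /subword -map_comp; apply: eq_map => i /=.
  by rewrite (nth_map x0) // -s_w.
have ellE : [seq ell i | i <- enum 'I_(size s)] = w.
  rewrite -[RHS](mkseq_nth x0) /mkseq -s_w -val_enum_ord -map_comp.
  exact: eq_map.
have n0 : (0 < size s)%N by rewrite s_w.
have E1 := moment_cumulant s.
have E2 := stack_count_NC st ell; rewrite ellE in E2.
have P1 := one_block_NC n0.
rewrite (bigD1 _ P1) /= big_set1 subword_setT in E1.
rewrite (bigD1 _ P1) /= big_set1 enum_setT -enumT ellE in E2.
have M : nc_phi _ (\prod_(a <- s) a) = (stack_count st w [::])%:R.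
  by rewrite big_map; exact: letters_moment.
rewrite M E2 natrD natr_sum in E1.
have E3 : \sum_(p in NC (size s) | p != [set [set: 'I_(size s)]%SET]%SET)
    \prod_(V in p) free_cumulant (subword V) =
  \sum_(p in NC (size s) | p != [set [set: 'I_(size s)]%SET]%SET)
    (\prod_(V in p) pair_weight st [seq ell i | i <- enum V])%:R :> C.
  apply: eq_bigr => p /andP[pNC pN1]; rewrite natr_prod; apply: eq_bigr => V Vp.
  rewrite subE IH// size_map -cardE.
  apply: leq_trans wm; rewrite -s_w.
  by move: pNC; rewrite inE => /andP[pT _]; exact: (partition_setT1 n0 pT Vp pN1).
rewrite E3 in E1.
exact/esym/(addIr _ E1).
Qed.

Lemma letter_semicircular x : st x = x -> semicircular1 (letter stK A x).
Proof.
move=> xx; split; first by rewrite star_letter xx.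
move=> n; rewrite -map_nseq fock_free_cumulant.
by case: n => [|[|[|n]]] //=; rewrite xx eqxx.
Qed.

Lemma letter_circular x : st x != x -> circular1 (letter stK A x).
Proof.
move=> xx e.
have -> : [seq (if b then nc_star (letter stK A x) else letter stK A x) | b <- e] =
    [seq letter stK A y | y <- [seq (if b then st x else x) | b <- e]].
  by rewrite -map_comp; apply: eq_map => -[] //=; exact: star_letter.
rewrite fock_free_cumulant; congr (_%:R).
by case: e => [|[] [|[] [|c e]]] //=;
  rewrite ?stK ?eqxx ?[x == st x]eq_sym ?(negPf xx) ?eqseq_cons ?andbF ?orbF.
Qed.

End FockCumulants.

(** * Letters for the permuted matrices and their adjoints *)

Lemma transpK N : involutive (transp N).
Proof. by move=> [i j]; rewrite !transpE. Qed.

Lemma conj_transpK N : involutive (@conj_transp N).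
Proof. by move=> s; apply/permP => p; rewrite !conj_transpE !transpK. Qed.

Section SymmetricLetters.
Variables (M1 M : nat).

(* A symmetric permutation yields a Hermitian matrix, so [A] and [A^*] are then
   one and the same letter. *)
Definition normal_symbol (p : 'I_M * bool) : bool := p.2 ==> (M1 <= p.1)%N.

Definition symbol : Type := {p : 'I_M * bool | normal_symbol p}.

HB.instance Definition _ := Choice.on symbol.

Fact normalizeP (k : 'I_M) (b : bool) : normal_symbol (k, b && (M1 <= k)%N).
Proof. by rewrite /normal_symbol /=; case: b => /=; rewrite ?implybb. Qed.

Definition normalize (p : 'I_M * bool) : symbol :=
  exist (fun q => is_true (normal_symbol q)) _ (normalizeP p.1 p.2).

Definition symbol_star (x : symbol) : symbol := normalize ((val x).1, ~~ (val x).2).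

Lemma symbol_starK : involutive symbol_star.
Proof.
move=> [[k b] H]; apply: val_inj; move: H; rewrite /normal_symbol /=.
by case: leqP; case: b.
Qed.

Lemma symbol_star_normalize k b : symbol_star (normalize (k, b)) = normalize (k, ~~ b).
Proof. by apply: val_inj; rewrite /=; case: leqP; case: b. Qed.

Variable mu : 'I_M -> forall N, entry_perm N.
Hypothesis mu_sym : forall (k : 'I_M) N, (k < M1)%N -> symmetric_perm (mu k N).

(** For Hermitian [G], the adjoint of [permute_entries G s] is [permute_entries G (conj_transp s)],
    so starred letters are again given by permutations. *)
Definition symbol_perm (x : symbol) N : entry_perm N :=
  if (val x).2 then conj_transp (mu (val x).1 N) else mu (val x).1 N.

Lemma symbol_perm_star x N : symbol_perm (symbol_star x) N = conj_transp (symbol_perm x N).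
Proof.
case: x => -[k b]; rewrite /normal_symbol /symbol_perm /=.
case: leqP => [_|kM]; case: b => //= _; last by rewrite mu_sym.
by rewrite conj_transpK.
Qed.

Lemma symbol_perm_normalize k b N :
  symbol_perm (normalize (k, b)) N = if b then conj_transp (mu k N) else mu k N.
Proof.
by rewrite /symbol_perm /=; case: leqP => kM; case: b => //=; rewrite mu_sym.
Qed.

Let card_le_inj N (A B : {set 'I_N * 'I_N * 'I_N}) h : injective h ->
  (forall z, z \in A -> h z \in B) -> (#|A| <= #|B|)%N.
Proof.
move=> hinj AB; rewrite -(card_imset A hinj); apply: subset_leq_card.
by apply/fintype.subsetP => _ /imsetP[z zA ->]; exact: AB.
Qed.

Let rot (N : nat) (z : 'I_N * 'I_N * 'I_N) := (z.1.2, z.2, z.1.1).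
Let mirror (N : nat) (z : 'I_N * 'I_N * 'I_N) := (z.2, z.1.2, z.1.1).
Let rot_inj N : injective (@rot N).
Proof. by move=> [[i j] k] [[i' j'] k'] [-> -> ->]. Qed.
Let mirror_inj N : injective (@mirror N).
Proof. by move=> [[i j] k] [[i' j'] k'] [-> -> ->]. Qed.

Let transp_eq N (p q : 'I_N * 'I_N) : (transp N p == transp N q) = (p == q).
Proof. exact: inj_eq perm_inj _ _. Qed.

(** The two steps of a path share the middle vertex. After the transposition is moved across, it is
    a common row index if [x] is unstarred and a common column index if [x] is starred; [rot] and
    [mirror] relabel the vertices accordingly. *)
Lemma meeting_count_overlap x y N : (val x).1 != (val y).1 ->
  (meeting_count (symbol_perm ^~ N) y x <=
   overlap_count (mu (val x).1 N) (mu (val y).1 N))%N.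
Proof.
case: x y => [[k2 b2] H2] [[k1 b1] H1] /= _; rewrite /meeting_count /overlap_count /symbol_perm /=.
clear H1 H2.
case: b2.
  apply: (card_le_inj (@mirror_inj N)) => -[[i j] k]; rewrite !inE /=.
  rewrite conj_transpE transpE transp_eq => /eqP ->.
  by case: b1; rewrite !inE ?eqxx ?orbT.
apply: (card_le_inj (@rot_inj N)) => -[[i j] k]; rewrite !inE /= => /eqP ->.
by case: b1; rewrite !inE !conj_transpE !transpE ?transpK ?eqxx ?orbT.
Qed.

(** Two letters of the same index that are not adjoint to each other are equal, and their index is
    at least [M1]. A meeting of a letter with itself is what [jcount] counts. *)
Lemma meeting_count_self x y N : (val x).1 = (val y).1 -> x != symbol_star y ->
  (M1 <= (val x).1)%N /\
  (meeting_count (symbol_perm ^~ N) y x <=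
   jcount (mu (val x).1 N) (mu (val x).1 N))%N.
Proof.
case: x y => [[k b2] H2] [[k1 b1] H1] /= e; subst k1 => ne.
have {ne} ne : b2 != ~~ b1 && (M1 <= k)%N.
  by apply: contraNneq ne => e; apply/eqP/val_inj; rewrite /= e.
have kM : (M1 <= k)%N.
  move: H1 H2 ne; rewrite /normal_symbol /=.
  by case: leqP => //=; case: b2; case: b1.
split=> //; rewrite kM andbT in ne.
rewrite /meeting_count /jcount /symbol_perm /=.
case: b2 b1 ne {H1 H2} => -[] // _.
  apply: (card_le_inj (@mirror_inj N)) => -[[i j] k']; rewrite !inE /=.
  by rewrite !conj_transpE !transpE transp_eq => /eqP ->.
apply: (card_le_inj (@inj_id _)) => -[[i j] k']; rewrite !inE /=.
by rewrite conj_transpE transpE => /eqP ->; rewrite transpK.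
Qed.

End SymmetricLetters.

(** * Passage to the complex limit and conclusion *)

Lemma is_o_square_le (R : realType) (u v : nat -> nat) :
  (forall N, u N <= v N)%N -> is_o_square R v -> is_o_square R u.
Proof.
move=> uv /eqoP vo; apply/eqoP => e e0; have := vo e e0.
apply: filterS => N; apply: le_trans.
by rewrite !ger0_norm ?ler0n// ler_nat.
Qed.

Lemma cvg_real_complex (R : realType) (u : nat -> R) (l : R) :
  u @ \oo --> l ->
  (fun n => real_complex R (u n) : (R[i] : numFieldType)) @ \oo -->
  (real_complex R l : (R[i] : numFieldType)).
Proof.
(* A positive element of [R[i]] has imaginary part 0, so the radius is a real number. *)
move=> ul; apply/cvgrPdist_le => -[e1 e2]; rewrite ltcE /= => /andP[/eqP e20 e10].
have /cvgrPdist_le /(_ _ e10) := ul; apply: filterS => n H.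
rewrite -rmorphB normc_def /= expr0n addr0 sqrtr_sqr lecE /= -e20 eqxx.
exact: H.
Qed.

Theorem theorem3p2 (R : realType) (M1 M2 : nat)
  (hM1 : (0 < M1)%N) (hM2 : (0 < M2)%N)
  (mu : 'I_(M1 + M2) -> forall N : nat, entry_perm N)
  (hsym : forall (k : 'I_(M1 + M2)) (N : nat),
     (k < M1)%N -> symmetric_perm (mu k N))
  (hj : forall k : 'I_(M1 + M2), (M1 <= k)%N ->
     is_o_square R (fun N => jcount (mu k N) (mu k N)))
  (hoverlap : forall a b : 'I_(M1 + M2), a != b ->
     is_o_square R (fun N => overlap_count (mu a N) (mu b N)))
  (d : nat -> measure_display) (T : forall N, measurableType (d N))
  (P : forall N, probability (T N) R)
  (G : forall N, T N -> 'M[R[i]]_N)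
  (hG : forall N, (0 < N)%N -> gaussian_matrix (P N) (@G N)) :
  exists (S : ncProbSpace R[i]) (a : 'I_(M1 + M2) -> S),
    [/\ limit_in_distribution P
          (fun N k w => permute_entries (G N w) (mu k N)) a,
        star_free a,
        forall k : 'I_(M1 + M2), (k < M1)%N -> semicircular1 (a k) &
        forall k : 'I_(M1 + M2), (M1 <= k)%N -> circular1 (a k)].
Proof.
pose C : numClosedFieldType := R[i].
pose A : freeAlgebra C (symbol M1 (M1 + M2)) := malg_freeAlgebra C _.
have stK := @symbol_starK M1 (M1 + M2).
pose a (k : 'I_(M1 + M2)) := letter stK A (normalize M1 (k, false)).
have a_star k : nc_star (a k) = letter stK A (normalize M1 (k, true)).
  by rewrite star_letter symbol_star_normalize.
exists (fock_space stK A), a; split.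
(* The matrices are Gaussian for positive sizes, so the sequence is shifted by one. *)
- move=> s; rewrite -cvg_shiftS.
  pose w := [seq normalize M1 x | x <- s].
  pose tau := @symbol_perm M1 _ mu.
  have -> : nc_star_moment a s = real_complex R (stack_count (@symbol_star M1 (M1 + M2)) w [::])%:R.
    rewrite rmorph_nat -(letters_moment stK A) /nc_star_moment big_map; congr (nc_phi _ _).
    by apply: eq_bigr => -[k []] _; [exact: a_star|].
  have -> : (fun N => star_moment (P N.+1)
        (fun k w => permute_entries (G N.+1 w) (mu k N.+1)) s : (R[i] : numFieldType)) =
      (fun N => real_complex R (stack_path_sum R (tau ^~ N.+1) [::] w / N.+1%:R)).
    apply/funext => N; rewrite -(trace_moment (tau ^~ N.+1) w (ltn0Sn N) (hG _ (ltn0Sn N))).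
    rewrite /star_moment; congr cexpectation; apply/funext => t.
    congr (\tr _ / _); rewrite big_map; apply: eq_bigr => -[k b] _ /=.
    rewrite /tau symbol_perm_normalize//.
    case: b => //; apply/matrixP => i j; rewrite !mxE conj_transpE transpE.
    (* Hermitian symmetry absorbs the conjugation and leaves the transposed position. *)
    have [H _ _ _ _] := hG _ (ltn0Sn N).
    by rewrite [RHS]H -transp_swap.
  apply: cvg_real_complex; apply: (@stack_path_sum_cvg R _ (@symbol_star _ _) tau _ _ [::]).
    by move=> x N; exact: symbol_perm_star.
  move=> y x xy; have [e|ne] := eqVneq (val x).1 (val y).1.
    have kM : (M1 <= (val x).1)%N by have [] := meeting_count_self mu 0 e xy.
    apply: (@is_o_square_le _ _ _ _ (hj _ kM)) => N.
    by have [] := meeting_count_self mu N e xy.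
  apply: (@is_o_square_le _ _ _ _ (hoverlap _ _ ne)) => N.
  exact: meeting_count_overlap.
- apply: (@letters_star_free _ _ _ stK A _ (fun x : symbol M1 (M1 + M2) => (val x).1)) => //.
- move=> k kM; apply: letter_semicircular; rewrite symbol_star_normalize.
  by apply: val_inj; rewrite /= leqNgt kM.
- move=> k kM; apply: letter_circular; rewrite symbol_star_normalize.
  by apply/eqP => /(congr1 (fun x => (val x).2)) /=; rewrite kM.
Qed.
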